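(* Let $m\ge 1$ and let $f:\mathbb{R}^m\to\mathbb{R}^m$ be a polynomial vector field of degree $d\ge 1$. Let $g$ be the normalized vector field on the closed unit ball $\overline{\mathcal{D}}\subset\mathbb{R}^m$ associated with $f$ via the Poincaré compactification $T(y)=y/\sqrt{1+\|y\|^2}$ (defined in the context), and assume that $g$ is $C^1$ on $\overline{\mathcal{D}}$. Let $x_\ast\in\partial\mathcal{D}$ be an equilibrium of $\frac{dx}{d\tau}=g(x)$, i.e. $\|x_\ast\|=1$ and $g(x_\ast)=0$. Assume that there is a compact neighborhood $\tilde N$ of $x_\ast$ in $\overline{\mathcal{D}}$ that admits a Lyapunov function of the form $L(x)=(x-x_\ast)^TY(x-x_\ast)$, where $Y$ is a real symmetric $m\times m$ matrix with positive eigenvalues, and that there is $\delta_0>0$ such that for every $x\in\tilde N$ every eigenvalue $\lambda_j(x)$ of the Jacobian matrix $Dg(x)$ satisfies $\mathrm{Re}(\lambda_j(x))\le-\delta_0<0$. Let $$c_1=\max\{\mu^{-1}:\mu \text{ is an eigenvalue of } Y\},$$ and let $c_{\tilde N}>0$ be a constant such that $c_1$ and $c_{\tilde N}$ satisfy $$\frac{dL}{d\tau}(x)<-c_{\tilde N}\|x-x_\ast\|^2\le -c_{\tilde N}c_1L(x)\qquad\text{for all }x\in\tilde N\setminus\{x_\ast\},$$ where $\frac{dL}{d\tau}(x)=\langle\nabla L(x),g(x)\rangle$ is the derivative of $L$ along solutions of $\frac{dx}{d\tau}=g(x)$. Let $N=\{x\in\overline{\mathcal{D}}: L(x)\le\varepsilon^2\}$,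 where $\varepsilon>0$ is such that $N\subset\tilde N$. Furthermore, let $\{x(\tau)\}_{\tau\in[0,\tau_N]}$ be a solution orbit of $\frac{dx}{d\tau}=g(x)$ with $x(0)=x_0\in\mathcal{D}$, such that $x(\tau_N)\in\mathrm{int}\,N$. Then $x(\tau)$ extends to all $\tau\in[0,\infty)$, and the mapping $y(t)$ defined by $y(t)=T^{-1}(x(\tau))$, $\tau\in[0,\infty)$, where $t=t(\tau)=\int_0^{\tau}(1-\|x(s)\|^2)^{\frac{d-1}{2}}ds$, is a solution of $\frac{dy}{dt}=f(y)$ with $y(0)=T^{-1}(x_0)$, whose maximal existence time $t_{\max}$ is contained in $[\underline{t_{\max}},\overline{t_{\max}}]$, where $$\underline{t_{\max}}=\int_0^{\tau_N}\left(1-\|x(\tau)\|^2\right)^{\frac{d-1}{2}}d\tau,\qquad \overline{t_{\max}}=\underline{t_{\max}}+\frac{2^{\frac{d-1}{2}}c_1^{\frac{d-5}{4}}}{c_{\tilde N}}\,\frac{4}{d-1}\,\varepsilon^{\frac{d-1}{2}}$$ (with $\overline{t_{\max}}=+\infty$ if $d=1$). In particular, if $\overline{t_{\max}}<\infty$, then $y(t)$ is a blow-up solution with blow-up time $t_{\max}\in[\underline{t_{\max}},\overline{t_{\max}}]$.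
   Context: $\langle\cdot,\cdot\rangle$ and $\|\cdot\|$ are the Euclidean inner product and norm on $\mathbb{R}^m$. $\mathcal{D}=\{x\in\mathbb{R}^m:\|x\|<1\}$. Maximal existence time and blow-up: for the initial value problem $\frac{dy}{dt}=f(y)$, $y(0)=y_0$, set $t_{\max}=\sup\{\bar t: \text{a solution } y\in C^1([0,\bar t)) \text{ exists}\}\in(0,\infty]$. The solution blows up if $t_{\max}<\infty$, and $t_{\max}$ is then called the blow-up time. Poincaré compactification: $T:\mathbb{R}^m\to\mathcal{D}$, $T(y)=y/\kappa$ with $\kappa=\sqrt{1+\|y\|^2}$; it is a bijection, and in terms of $x=T(y)$ one has $\kappa=(1-\|x\|^2)^{-1/2}$. Normalized vector field: write $f=p_0+p_1+\cdots+p_d$, where each $p_j:\mathbb{R}^m\to\mathbb{R}^m$ is homogeneous polynomial of degree $j$ and $p_d\not\equiv0$. Put $$\tilde f(x)=\sum_{j=0}^d (1-\|x\|^2)^{\frac{d-j}{2}}p_j(x)\quad(x\in\overline{\mathcal{D}}),$$ so $\tilde f(x)=\kappa^{-d}f(\kappa x)$ for $x\in\mathcal{D}$ and $\tilde f(x)=p_d(x)$ for $\|x\|=1$. Then $g(x)=\tilde f(x)-\langle x,\tilde f(x)\rangle x$ on $\overline{\mathcal{D}}$. The system $\frac{dx}{d\tau}=g(x)$ arises from $\frac{dy}{dt}=f(y)$ by $x=T(y)$ and the time change $\frac{d\tau}{dt}=\kappa(y(t))^{d-1}$. ''$g$ is $C^1$ on $\overline{\mathcal{D}}$'' means that $g|_{\mathcal{D}}$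 extends $C^1$-smoothly to $\overline{\mathcal{D}}$; $Dg$ on $\partial\mathcal{D}$ is the continuous extension. Lyapunov function: a $C^1$ function $L$ defined on an open neighborhood of a compact set $\tilde N$ is a Lyapunov function on $\tilde N$ if (1) its derivative along the flow satisfies $\langle\nabla L(x),g(x)\rangle\le0$ for all $x\in\tilde N$, and (2) whenever this derivative vanishes at a point of $\tilde N$, that point is an equilibrium of the flow. Neighborhoods and interiors of subsets of $\overline{\mathcal{D}}$ are taken relative to $\overline{\mathcal{D}}$. *)

(* Defs.v *)
From HB Require Import structures.
From mathcomp Require Import all_boot all_order all_algebra.
From mathcomp Require Import all_classical all_reals all_analysis.
From mathcomp Require Import complex.
(* The notations of mpoly clash with those of mathcomp-analysis. *)
From mathcomp.multinomials Require Import -(notations) mpoly.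

Set Implicit Arguments.
Unset Strict Implicit.
Unset Printing Implicit Defensive.

Import Order.TTheory GRing.Theory Num.Theory numFieldNormedType.Exports.
Local Open Scope classical_set_scope.
Local Open Scope ring_scope.

Section Euclidean.
Context {R : realType} {m : nat}.
Implicit Types (u v x y : 'rV[R]_m) (A N : set 'rV[R]_m).

(* The library norm `|x| on 'rV[R]_m is the sup norm, hence [enorm]; both
   induce the topology used below. *)
Definition dotp u v : R := \sum_i u 0 i * v 0 i.
Definition enorm u : R := Num.sqrt (dotp u u).

Definition disc : set 'rV[R]_m := [set x | enorm x < 1].
Definition cdisc : set 'rV[R]_m := [set x | enorm x <= 1].

Definition rel_interior A N : set 'rV[R]_m :=
  [set z | A z /\ within A (nbhs z) N].

Definition gradient (L : 'rV[R]_m -> R) x : 'rV[R]_m :=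
  \row_i 'D_(delta_mx 0 i) L x.

(* dL/dtau along the solutions of dx/dtau = g x *)
Definition orbital_derivative (g : 'rV[R]_m -> 'rV[R]_m) (L : 'rV[R]_m -> R) x : R :=
  dotp (gradient L x) (g x).

Definition C1_on_open (U : set 'rV[R]_m) (L : 'rV[R]_m -> R) : Prop :=
  forall x, U x -> differentiable L x /\ {for x, continuous (gradient L)}.

Definition lyapunov_function (g : 'rV[R]_m -> 'rV[R]_m) (L : 'rV[R]_m -> R) N : Prop :=
  [/\ exists U : set 'rV[R]_m, [/\ open U, N `<=` U & C1_on_open U L],
      forall x, N x -> orbital_derivative g L x <= 0 &
      forall x, N x -> orbital_derivative g L x = 0 -> g x = 0].

(* g is C^1 on the closed ball, with Dg the continuous extension to the closed
   ball of the Jacobian of g on the open ball.  The library's ['J g x] acts on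
   row vectors from the right, so it is the transpose of the usual Jacobian
   matrix; it has the same eigenvalues. *)
Definition C1_on_cdisc (g : 'rV[R]_m -> 'rV[R]_m) (Dg : 'rV[R]_m -> 'M[R]_m) : Prop :=
  [/\ forall x, disc x -> differentiable g x,
      forall x, disc x -> Dg x = 'J g x,
      {within cdisc, continuous g} &
      {within cdisc, continuous Dg}].

End Euclidean.

Section ODE.
Context {R : realType} {m : nat}.
Implicit Types (F : 'rV[R]_m -> 'rV[R]_m) (y : R -> 'rV[R]_m) (I : set R).

(* y is of class C^1 on I and y' = F(y) there; the derivative is taken within I,
   hence is one-sided at an endpoint belonging to I. *)
Definition solution F I y : Prop :=
  (forall t, I t -> (s - t)^-1 *: (y s - y t) @[s --> within I t^'] --> F (y t))
  /\ {within I, continuous (F \o y)}.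

Definition tmax F (y0 : 'rV[R]_m) : \bar R :=
  ereal_sup [set tb%:E | tb in
    [set tb : R | 0 < tb /\ exists y, solution F `[0, tb[ y /\ y 0 = y0]].

Definition blows_up F (y0 : 'rV[R]_m) : Prop := (tmax F y0 < +oo)%E.

End ODE.

Section Poincare.
Context {R : realType} {m : nat}.
Implicit Types x y : 'rV[R]_m.

Definition kappa y : R := Num.sqrt (1 + enorm y ^+ 2).
Definition poincare y : 'rV[R]_m := (kappa y)^-1 *: y.
(* Only meaningful on the open ball. *)
Definition poincare_inv x : 'rV[R]_m := (Num.sqrt (1 - enorm x ^+ 2))^-1 *: x.

Lemma dotp_ge0 x : 0 <= dotp x x.
Proof. by apply: sumr_ge0 => i _; rewrite -expr2 sqr_ge0. Qed.

Lemma enorm_ge0 x : 0 <= enorm x.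
Proof. exact: sqrtr_ge0. Qed.

Lemma enormZ a x : enorm (a *: x) = `|a| * enorm x.
Proof.
rewrite /enorm -sqrtr_sqr -sqrtrM ?sqr_ge0//; congr Num.sqrt.
rewrite /dotp mulr_sumr; apply: eq_bigr => i _.
by rewrite !mxE expr2 mulrACA.
Qed.

Lemma kappa_gt0 y : 0 < kappa y.
Proof. by rewrite sqrtr_gt0 ltr_pwDl// sqr_ge0. Qed.

Lemma sqr_kappa y : kappa y ^+ 2 = 1 + enorm y ^+ 2.
Proof. by rewrite sqr_sqrtr// addr_ge0// sqr_ge0. Qed.

Lemma enorm_poincare y : enorm (poincare y) = enorm y / kappa y.
Proof. by rewrite enormZ gtr0_norm ?invr_gt0 ?kappa_gt0// mulrC. Qed.

Lemma one_sub_enorm_poincare y : 1 - enorm (poincare y) ^+ 2 = (kappa y ^+ 2)^-1.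
Proof.
rewrite enorm_poincare expr_div_n.
have k0 : kappa y ^+ 2 != 0 by rewrite expf_neq0// gt_eqF// kappa_gt0.
apply: (mulIf k0); rewrite mulVf// mulrBl divfK// mul1r sqr_kappa.
by rewrite addrK.
Qed.

Lemma poincare_disc y : disc (poincare y).
Proof.
rewrite /disc/= -(@ltr_pXn2r _ 2%N)// ?nnegrE ?enorm_ge0//.
rewrite expr1n -subr_gt0 one_sub_enorm_poincare invr_gt0 exprn_gt0//.
exact: kappa_gt0.
Qed.

Lemma poincareK : cancel poincare poincare_inv.
Proof.
move=> y; rewrite /poincare_inv one_sub_enorm_poincare sqrtrV ?sqr_ge0// invrK.
rewrite sqrtr_sqr gtr0_norm ?kappa_gt0// /poincare scalerA divff ?scale1r//.
by rewrite gt_eqF// kappa_gt0.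
Qed.

Lemma poincare_invK x : disc x -> poincare (poincare_inv x) = x.
Proof.
rewrite /disc/= => x1; set r := 1 - enorm x ^+ 2.
have r0 : 0 < r by rewrite subr_gt0 expr_lt1// enorm_ge0.
have s0 : 0 < Num.sqrt r by rewrite sqrtr_gt0.
have kE : kappa (poincare_inv x) = (Num.sqrt r)^-1.
  rewrite /kappa enormZ gtr0_norm ?invr_gt0// exprMn exprVn sqr_sqrtr ?ltW//.
  rewrite -sqrtrV ?ltW//; congr Num.sqrt.
  apply: (mulfI (lt0r_neq0 r0)); rewrite mulrDr mulrA divff ?gt_eqF// mulr1 mul1r.
  by rewrite subrK.
by rewrite /poincare kE invrK scalerA divff ?scale1r// gt_eqF.
Qed.

End Poincare.

Section NormalizedField.
Context {R : realType} {m : nat}.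
Implicit Types (f : 'I_m -> mpoly m R) (x : 'rV[R]_m).

(* The polynomial vector field with components f i. *)
Definition vfield f x : 'rV[R]_m := \row_i meval (fun j => x 0 j) (f i).

(* [mmeasure mdeg p] is 1 + the total degree of p, and 0 for p = 0. *)
Definition vdegree f (d : nat) : Prop :=
  (\max_i mmeasure (@mdeg m) (f i))%N = d.+1.

(* The homogeneous part p_j of degree j. *)
Definition homog_part f (j : nat) : 'I_m -> mpoly m R :=
  fun i => pihomog (@mdeg m) j (f i).

(* Here 0 `^ 0 = 1, so that ftilde = p_d on the unit sphere. *)
Definition ftilde f (d : nat) x : 'rV[R]_m :=
  \sum_(j < d.+1)
    ((1 - enorm x ^+ 2) `^ ((d - j)%N%:R / 2)) *: vfield (homog_part f j) x.

Definition normalized_field f d x : 'rV[R]_m :=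
  ftilde f d x - dotp x (ftilde f d x) *: x.

(* t(tau), the inverse of the time change dtau/dt = kappa(y)^(d-1). *)
Definition original_time (d : nat) (x : R -> 'rV[R]_m) (tau : R) : R :=
  \int[lebesgue_measure]_(s in `[0, tau])
    (1 - enorm (x s) ^+ 2) `^ ((d%:R - 1) / 2).

End NormalizedField.

(* Main.v *)
(** The field [g] is Lipschitz on the closed ball, so composing it with the
    radial retraction gives a globally Lipschitz field whose flow [X] exists
    for all (also negative) times.  The function [z = 1 - |X|^2] satisfies
    [|z'| <= C |z|], hence never vanishes, and [X] stays in the open ball and
    solves [dx/dtau = g x].  The set [L <= eps^2] is forward invariant, and [L]
    decays exponentially there; since [1 - |X|^2 <= 2 |X - xs|] and
    [|X - xs|^2 <= c1 L], the speed [(1 - |X|^2)^((d-1)/2)] of the time change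
    decays exponentially too, and integrating it gives the upper bound.
    Conversely [T^-1 (X tau)] is unbounded, so no solution of [dy/dt = f y] can
    live past all the times [t(tau)]: the maximal existence time is exactly
    the total transformed time. *)
Require Import Defs.
From HB Require Import structures.
From mathcomp Require Import all_boot all_order all_algebra.
From mathcomp Require Import all_classical all_reals all_analysis.
From mathcomp Require Import complex.
From mathcomp.multinomials Require Import -(notations) mpoly.
From mathcomp Require Import ring lra.

Set Implicit Arguments.
Unset Strict Implicit.
Unset Printing Implicit Defensive.

Import Order.TTheory GRing.Theory Num.Theory numFieldNormedType.Exports.
Local Open Scope classical_set_scope.
Local Open Scope ring_scope.

(** * The Euclidean norm *)

(** [g] is Lipschitz up to the sphere by strict convexity: the open segment between two points of
    the closed ball lies in the open ball, where [g] is differentiable with bounded Jacobian.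
    Invariance of the open ball comes from <x, g x> = <x, ftilde x> (1 - |x|^2): the radial speed
    carries a factor vanishing on the sphere, and outside the ball the retracted field is orthogonal
    to the position. Running the flow in both time directions makes every derivative two-sided, so
    the time change can be inverted even at t = 0. Constants: let p = (d-1)/2. [L] decays at rate b
    = cN c1, hence the bound on 1 - |X|^2 at rate b/2 and the one on the speed at rate b p/2.
    Integration divides by b p/2 = cN c1 (d-1)/4, which produces 4/(d-1) and lowers the exponent of
    c1 from (d-1)/4 to (d-5)/4. [tmax] is a supremum over all solutions, so the upper bound must
    rule out every competitor; uniqueness in the original variables forces each of them to follow
    T^-1 X. *)

Section EuclideanNorm.
Context {R : realType} {m : nat}.
Implicit Types (u v w : 'rV[R]_m) (a : R).

Lemma dotpC u v : dotp u v = dotp v u.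
Proof. by apply: eq_bigr => i _; rewrite mulrC. Qed.

Lemma dotpDl u v w : dotp (u + v) w = dotp u w + dotp v w.
Proof. by rewrite /dotp -big_split; apply: eq_bigr => i _; rewrite !mxE mulrDl. Qed.

Lemma dotpZl a u v : dotp (a *: u) v = a * dotp u v.
Proof. by rewrite /dotp mulr_sumr; apply: eq_bigr => i _; rewrite !mxE mulrA. Qed.

Lemma dotpDr u v w : dotp w (u + v) = dotp w u + dotp w v.
Proof. by rewrite dotpC dotpDl !(dotpC w). Qed.

Lemma dotpZr a u v : dotp u (a *: v) = a * dotp u v.
Proof. by rewrite dotpC dotpZl dotpC. Qed.

Lemma dotpNl u v : dotp (- u) v = - dotp u v.
Proof. by rewrite -scaleN1r dotpZl mulN1r. Qed.

Lemma dotpNr u v : dotp u (- v) = - dotp u v.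
Proof. by rewrite dotpC dotpNl dotpC. Qed.

Lemma dotp0l u : dotp 0 u = 0.
Proof. by rewrite -(scale0r u) dotpZl mul0r. Qed.

Lemma dotp0r u : dotp u 0 = 0.
Proof. by rewrite dotpC dotp0l. Qed.

Lemma dotpE u v : dotp u v = (u *m v^T) 0 0.
Proof. by rewrite mxE; apply: eq_bigr => i _; rewrite !mxE. Qed.

Lemma sqr_enorm u : enorm u ^+ 2 = dotp u u.
Proof. by rewrite sqr_sqrtr// dotp_ge0. Qed.

Lemma enormN u : enorm (- u) = enorm u.
Proof. by rewrite -scaleN1r enormZ normrN1 mul1r. Qed.

Lemma sqr_coord_le_dotp u i : u 0 i ^+ 2 <= dotp u u.
Proof.
rewrite /dotp (bigD1 i)//= expr2 lerDl; apply: sumr_ge0 => j _.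
by rewrite -expr2 sqr_ge0.
Qed.

Lemma coord_le_enorm u i : `|u 0 i| <= enorm u.
Proof. by rewrite -sqrtr_sqr ler_sqrt ?dotp_ge0// sqr_coord_le_dotp. Qed.

Lemma coord_le_norm u i : `|u 0 i| <= `|u|.
Proof. by rewrite [leRHS]/Num.Def.normr/= mx_normrE (le_bigmax _ _ (0, i)). Qed.

Lemma rV_norm_le u a : 0 <= a -> (forall i, `|u 0 i| <= a) -> `|u| <= a.
Proof.
move=> a0 ua; rewrite [leLHS]/Num.Def.normr/= mx_normrE bigmax_le// => -[i j] _ /=.
by rewrite ord1.
Qed.

Lemma norm_le_enorm u : `|u| <= enorm u.
Proof. by apply: rV_norm_le => [|i]; rewrite ?enorm_ge0// coord_le_enorm. Qed.

Lemma enorm_le_norm u : enorm u <= m%:R * `|u|.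
Proof.
rewrite -(@ler_pXn2r _ 2)// ?nnegrE ?enorm_ge0 ?mulr_ge0// sqr_enorm.
apply: (@le_trans _ _ (m%:R * `|u| ^+ 2)).
  rewrite -[leLHS]mulr1 mulr1 /dotp.
  apply: le_trans (_ : \sum_(i < m) `|u| ^+ 2 <= _); last first.
    by rewrite sumr_const card_ord mulr_natl.
  apply: ler_sum => i _; rewrite -expr2 -real_normK ?num_real//.
  by rewrite ler_pXn2r ?nnegrE// coord_le_norm.
rewrite exprMn ler_wpM2r ?sqr_ge0//.
by case: (m) => [|k]; rewrite ?expr0n// -natrX ler_nat leq_pmulr.
Qed.

Lemma dotp_eq0 u : dotp u u = 0 -> u = 0.
Proof.
move=> u0; apply/rowP => i; rewrite mxE; apply/eqP.
by rewrite -sqrf_eq0 eq_le sqr_ge0 -u0 sqr_coord_le_dotp.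
Qed.

Lemma dotp_le u v : `|dotp u v| <= enorm u * enorm v.
Proof.
rewrite -(@ler_pXn2r _ 2)// ?nnegrE ?mulr_ge0 ?enorm_ge0//.
rewrite real_normK ?num_real// exprMn !sqr_enorm.
have [/dotp_eq0 ->|v0] := eqVneq (dotp v v) 0.
  by rewrite !dotp0r expr0n mulr0.
have {}v0 : 0 < dotp v v by rewrite lt_neqAle eq_sym v0 dotp_ge0.
(* This is |v|^2 times the component of u orthogonal to v; its squared length is |v|^2 (|u|^2 |v|^2
   - <u,v>^2). *)
have := dotp_ge0 (dotp v v *: u - dotp u v *: v).
rewrite -scaleNr !(dotpDl, dotpDr, dotpZl, dotpZr) (dotpC v u) => h.
rewrite -subr_ge0 -(pmulr_rge0 _ v0); apply: le_trans h _.
by rewrite le_eqVlt; apply/orP; left; apply/eqP; ring.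
Qed.

Lemma enormD u v : enorm (u + v) <= enorm u + enorm v.
Proof.
rewrite -(@ler_pXn2r _ 2)// ?nnegrE ?addr_ge0 ?enorm_ge0//.
rewrite sqrrD !sqr_enorm dotpDl !dotpDr (dotpC v u).
have := le_trans (ler_norm _) (dotp_le u v); lra.
Qed.

Lemma enorm_dist u v : `|enorm u - enorm v| <= enorm (u - v).
Proof.
have h (a b : 'rV[R]_m) : enorm a - enorm b <= enorm (a - b).
  by rewrite lerBlDr -{1}(subrK b a) enormD.
by rewrite ler_norml h lerNl opprB -(opprB v u) enormN h.
Qed.

Lemma enorm_continuous : continuous (@enorm R m).
Proof.
move=> u; apply/(@cvgrPdist_lt _ _ _ (nbhs u)) => e e0.
have m0 : 0 < m%:R + 1 :> R by rewrite ltr_wpDl.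
near=> v; apply: le_lt_trans (enorm_dist _ _) _.
apply: le_lt_trans (enorm_le_norm _) _.
apply: (@le_lt_trans _ _ ((m%:R + 1) * `|u - v|)).
  by rewrite ler_wpM2r// lerDl.
rewrite -ltr_pdivlMl// mulrC; near: v.
have := @cvg_id _ (nbhs u); move=> /cvgrPdist_lt; apply; rewrite divr_gt0.
Unshelve. all: by end_near. Qed.

Lemma compact_cdisc : compact (@cdisc R m).
Proof.
apply: bounded_closed_compact.
  exists 1; split=> // M M1 u /= u1.
  exact: le_trans (norm_le_enorm _) (le_trans u1 (ltW M1)).
rewrite (_ : cdisc = enorm @^-1` [set r | r <= 1]); last by [].
by apply: preimage_closed; [move=> u _; exact: enorm_continuous|exact: closed_le].
Qed.

Lemma compact_sphere : compact [set u : 'rV[R]_m | enorm u = 1].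
Proof.
apply: (subclosed_compact _ compact_cdisc) => [|u]; last first.
  by rewrite /cdisc/= => ->.
rewrite (_ : [set _ | _] = enorm @^-1` [set 1]); last by [].
by apply: preimage_closed; [move=> u _; exact: enorm_continuous|exact: closed_eq].
Qed.

Lemma sum_continuous (T : topologicalType) (n : nat) (F : 'I_n -> T -> R) :
  (forall i, continuous (F i)) -> continuous (fun x => \sum_i F i x).
Proof.
by move=> cF; apply: continuous_big => //; exact: add_continuous.
Qed.

Lemma qform_continuous (Y : 'M[R]_m) : continuous (fun w => dotp (w *m Y) w).
Proof.
have cX i : continuous (fun w : 'rV[R]_m => w 0 i) by exact: coord_continuous.
have cY i : continuous (fun w : 'rV[R]_m => (w *m Y) 0 i).
  rewrite (_ : (fun _ => _) = fun w => \sum_j w 0 j * Y j i); last first.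
    by apply/funext => w; rewrite mxE.
  apply: sum_continuous => j v.
  by apply: continuousM; [exact: cX|exact: cst_continuous].
apply: sum_continuous => i w.
by apply: continuousM; [exact: cY|exact: cX].
Qed.

(** The quadratic form attains its minimum on the compact sphere, and the first variation there
    shows that the minimizer is an eigenvector. Since [mu] is a genuine eigenvalue, [c1] bounds its
    inverse. *)
Lemma rayleigh_min (Y : 'M[R]_m) : (0 < m)%N -> Y^T = Y ->
  exists2 mu, eigenvalue Y mu & forall w, mu * dotp w w <= dotp (w *m Y) w.
Proof.
move=> m0 Ysym.
have [v vS vmin] : exists2 v, v \in [set u : 'rV[R]_m | enorm u = 1] &
    forall t, t \in [set u : 'rV[R]_m | enorm u = 1] ->
      dotp (v *m Y) v <= dotp (t *m Y) t.
  apply: EVT_min_rV compact_sphere _; last first.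
    exact/continuous_subspaceT/qform_continuous.
  exists (delta_mx 0 (Ordinal m0)); rewrite /= /enorm /dotp.
  rewrite (bigD1 (Ordinal m0))//= big1 ?addr0 => [|j /negbTE j0].
    by rewrite !mxE !eqxx mulr1 sqrtr1.
  by rewrite !mxE j0 andbF mulr0.
set mu := dotp (v *m Y) v in vmin.
move: vS; rewrite inE/= => v1.
have vv : dotp v v = 1 by rewrite -sqr_enorm v1 expr1n.
have ray w : mu * dotp w w <= dotp (w *m Y) w.
  have [w0|w0] := eqVneq (dotp w w) 0.
    by rewrite w0 mulr0 (dotp_eq0 w0) dotp0r.
  have n0 : 0 < enorm w by rewrite sqrtr_gt0 lt_neqAle eq_sym w0 dotp_ge0.
  have := vmin ((enorm w)^-1 *: w).
  rewrite inE/= enormZ gtr0_norm ?invr_gt0// mulVf ?gt_eqF// => /(_ erefl).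
  rewrite -scalemxAl dotpZl dotpZr mulrA -invfM -expr2 sqr_enorm mulrC.
  by rewrite ler_pdivlMr// lt_neqAle eq_sym w0 dotp_ge0.
exists mu => //; apply/eigenvalueP; exists v; last first.
  apply/eqP => v0; move: vv; rewrite v0 dotp0r => /eqP.
  by rewrite eq_sym oner_eq0.
have symm (a b : 'rV[R]_m) : dotp (a *m Y) b = dotp (b *m Y) a.
  have -> : dotp (a *m Y) b = ((a *m Y *m b^T)^T) 0 0 by rewrite mxE -dotpE.
  by rewrite dotpE !trmx_mul trmxK Ysym mulmxA.
have [r rE] : exists r, v *m Y - mu *: v = r by eexists.
apply/eqP; rewrite -subr_eq0 rE; apply/eqP.
(* Testing minimality at v - t r and letting t be small forces r = 0. *)
apply: dotp_eq0; apply/eqP/contraT => r0.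
have {}r0 : 0 < dotp r r by rewrite lt_neqAle eq_sym r0 dotp_ge0.
have rrE : dotp (v *m Y) r - mu * dotp v r = dotp r r.
  by rewrite -dotpZl -dotpNl -dotpDl rE.
pose q := dotp (r *m Y) r - mu * dotp r r.
have key t : 0 <= - 2 * t * dotp r r + t ^+ 2 * q.
  have := ray (v - t *: r).
  rewrite -scaleNr mulmxDl -scalemxAl !(dotpDl, dotpDr, dotpZl, dotpZr).
  rewrite (symm r v) (dotpC r v) vv -/mu /q -rrE -subr_ge0 => h.
  apply: le_trans h _; rewrite le_eqVlt; apply/orP; left; apply/eqP; ring.
have q0 : 0 < q.
  have := key 1; rewrite expr1n; lra.
(* The minimizer of the quadratic polynomial of [key], whose value there is negative. *)
have := key (dotp r r / q).
rewrite (_ : _ + _ = - (dotp r r ^+ 2 / q)); last by field; rewrite gt_eqF.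
by rewrite oppr_ge0 leNgt divr_gt0// exprn_gt0.
Qed.

End EuclideanNorm.

(** * Real calculus: derivatives, signed primitives and exponential bounds *)

Section RealCalculus.
Context {R : realType}.
Implicit Types (f g : R -> R) (t : R).

Lemma is_derive_add f g t (df dg : R) : is_derive t 1 f df ->
  is_derive t 1 g dg -> is_derive t 1 (fun s => f s + g s) (df + dg).
Proof. by move=> hf hg; exact: is_deriveD. Qed.

Lemma is_derive_sub f g t (df dg : R) : is_derive t 1 f df ->
  is_derive t 1 g dg -> is_derive t 1 (fun s => f s - g s) (df - dg).
Proof. by move=> hf hg; exact: is_deriveB. Qed.

Lemma is_derive_mul f g t (df dg : R) : is_derive t 1 f df ->
  is_derive t 1 g dg -> is_derive t 1 (fun s => f s * g s) (df * g t + f t * dg).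
Proof.
move=> hf hg; apply: (@is_derive_eq _ _ _ (f * g)%R).
by rewrite addrC [df * _]mulrC.
Qed.

Lemma is_derive_scale (c : R) f t (df : R) : is_derive t 1 f df ->
  is_derive t 1 (fun s => c * f s) (c * df).
Proof. by move=> hf; exact: is_deriveZ. Qed.

Lemma is_derive_big n (F : 'I_n -> R -> R) t (dF : 'I_n -> R) :
  (forall i, is_derive t 1 (F i) (dF i)) ->
  is_derive t 1 (fun s => \sum_i F i s) (\sum_i dF i).
Proof.
move=> dFt; rewrite (_ : (fun s => _) = \sum_i F i); first exact: is_derive_sum.
by apply/funext => s; rewrite fct_sumE.
Qed.

Lemma is_derive_expRM (c t : R) :
  is_derive t 1 (fun s => expR (c * s)) (c * expR (c * t)).
Proof.
have h : is_derive t 1 (fun s => c * s) (c * 1).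
  by apply: is_derive_scale; exact: is_derive_id.
apply: (@is_derive_eq _ _ _ (expR \o (fun s => c * s))).
by rewrite mulr1 mulrC.
Qed.

Lemma is_derive_continuous f t (df : R) : is_derive t 1 f df ->
  {for t, continuous f}.
Proof.
by case=> h _; exact/differentiable_continuous/derivable1_diffP.
Qed.

Lemma nondecreasing_itv f (df : R -> R) a b : a <= b ->
  (forall t, a < t < b -> is_derive t 1 f (df t)) ->
  (forall t, a < t < b -> 0 <= df t) ->
  {within `[a, b], continuous f} -> f a <= f b.
Proof.
move=> ab hf df0 cf; apply: (@ger0_derive1_ndecr _ f a b) => // t.
  by rewrite in_itv/= => /hf [].
by rewrite in_itv/= => tab; rewrite derive1E; case: (hf _ tab) => _ ->; exact: df0.
Qed.

Lemma nondecreasing_line f (df : R -> R) a b : a <= b ->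
  (forall t, is_derive t 1 f (df t)) ->
  (forall t, a < t < b -> 0 <= df t) -> f a <= f b.
Proof.
move=> ab hf df0; apply: (@nondecreasing_itv _ df) => //.
by apply: continuous_subspaceT => t; exact: is_derive_continuous (hf t).
Qed.

(** The oriented integral from 0 to t, so that Picard iteration also runs backwards in time. *)
Definition primitive (h : R -> R) (t : R) : R :=
  if 0 <= t then \int[lebesgue_measure]_(s in `[0, t]) h s
  else - \int[lebesgue_measure]_(s in `[t, 0]) h s.

Lemma primitive_ge0 h t : 0 <= t ->
  primitive h t = \int[lebesgue_measure]_(s in `[0, t]) h s.
Proof. by rewrite /primitive => ->. Qed.

Lemma primitive0 h : primitive h 0 = 0.
Proof. by rewrite primitive_ge0// set_itv1 Rintegral_set1. Qed.

(** A base point to the left of both 0 and s removes the case distinction on signs, so that the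
    fundamental theorem for a fixed lower end applies. *)
Lemma primitive_shift h a s : continuous h -> a < 0 -> a < s ->
  primitive h s = \int[lebesgue_measure]_(u in `[a, s]) h u
                  - \int[lebesgue_measure]_(u in `[a, 0]) h u.
Proof.
move=> ch a0 as_.
have ih u v : lebesgue_measure.-integrable `[u, v] (EFin \o h).
  apply: continuous_compact_integrable; first exact: segment_compact.
  exact: continuous_subspaceT.
have oc u v : \int[lebesgue_measure]_(z in `[u, v]) h z =
              \int[lebesgue_measure]_(z in `]u, v]) h z.
  by rewrite Rintegral_itv_obnd_cbnd//; apply: integrableS (ih u v) => //;
    apply: subset_itvr; rewrite bnd_simp.
rewrite /primitive; case: ifPn => [s0|]; last rewrite -ltNge => s0.
  by rewrite (oc 0 s) -(@Rintegral_itvB _ h (BLeft a) (BRight s) 0)// ?bnd_simp// ltW.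
rewrite (oc s 0) -(@Rintegral_itvB _ h (BLeft a) (BRight 0) s)// ?bnd_simp ?ltW//.
by rewrite opprB.
Qed.

Lemma is_derive_primitive h t : continuous h -> is_derive t 1 (primitive h) (h t).
Proof.
move=> ch; pose a := Num.min t 0 - 1.
have a0 : a < 0 by rewrite ltrBlDr add0r gt_min ltr01 orbT.
have at_ : a < t by rewrite ltrBlDr gt_min ltrDl ltr01.
have ih u v : lebesgue_measure.-integrable `[u, v] (EFin \o h).
  apply: continuous_compact_integrable; first exact: segment_compact.
  exact: continuous_subspaceT.
have t1 : t < t + 1 by rewrite ltrDl.
have [dF F'] := continuous_FTC1_closed t1 (ih a (t + 1)) at_ (ch t).
have {dF F'} hF : is_derive t 1
    (fun s => \int[lebesgue_measure]_(u in `[a, s]) h u) (h t).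
  by apply: DeriveDef; [exact: dF|rewrite -derive1E; exact: F'].
have := is_derive_sub hF
  (is_derive_cst (\int[lebesgue_measure]_(u in `[a, 0]) h u) t 1).
rewrite subr0; apply: near_eq_is_derive.
by near=> s; rewrite -primitive_shift//; near: s; exact: lt_nbhsr.
Unshelve. all: by end_near. Qed.

Lemma exp_bound_half f (df : R -> R) (M a : R) : 0 < a -> f 0 = 0 ->
  (forall t, is_derive t 1 f (df t)) ->
  (forall t, df t <= M * expR (a * `|t|)) -> 0 <= M ->
  forall t, 0 <= t -> f t <= M / a * expR (a * t).
Proof.
move=> a0 f0 hf dfM M0 t t0.
have : M / a * expR (a * 0) - f 0 <= M / a * expR (a * t) - f t.
  apply: (@nondecreasing_line (fun s => M / a * expR (a * s) - f s)
    (fun s => M / a * (a * expR (a * s)) - df s)) => //.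
    move=> s; apply: is_derive_sub => //; apply: is_derive_scale.
    exact: is_derive_expRM.
  move=> s /andP[s0 _]; rewrite mulrA divfK ?gt_eqF// subr_ge0.
  by have := dfM s; rewrite gtr0_norm.
rewrite f0 subr0 mulr0 expR0 mulr1 => h.
by rewrite -subr_ge0 (le_trans _ h)// divr_ge0// ltW.
Qed.

(** Integration divides the constant of an exp(a|t|) bound by [a]: the source of the contraction
    factor in Picard iteration. Reflecting the sign and the time reduces it to [exp_bound_half],
    where M/a exp(a t) - f is nondecreasing and starts at M/a. *)
Lemma exp_bound f (df : R -> R) (M a : R) : 0 < a -> f 0 = 0 ->
  (forall t, is_derive t 1 f (df t)) ->
  (forall t, `|df t| <= M * expR (a * `|t|)) ->
  forall t, `|f t| <= M / a * expR (a * `|t|).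
Proof.
move=> a0 f0 hf dfM t.
have M0 : 0 <= M.
  by have := dfM 0; rewrite normr0 mulr0 expR0 mulr1; apply: le_trans.
have hN (g dg : R -> R) : (forall t, is_derive t 1 g (dg t)) ->
    forall t, is_derive t 1 (fun s => - g s) (- dg t).
  by move=> hg s; exact: is_deriveN.
have hR (g dg : R -> R) : (forall t, is_derive t 1 g (dg t)) ->
    forall t, is_derive t 1 (fun s => g (- s)) (- dg (- t)).
  move=> hg s; rewrite -mulrN1.
  exact: (@is_derive1_comp _ g -%R s (dg (- s)) (-1) (hg _) (is_deriveNid _ _)).
have fM s : df s <= M * expR (a * `|s|) by apply: le_trans (ler_norm _) (dfM _).
have fMN s : - df s <= M * expR (a * `|s|).
  by apply: le_trans (ler_norm _) _; rewrite normrN.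
rewrite ler_norml lerNl; have [t0|t0] := leP 0 t.
  rewrite (ger0_norm t0) (exp_bound_half a0 f0 hf)// ?andbT.
  by apply: (exp_bound_half a0 _ (hN _ _ hf)) => //; rewrite f0 oppr0.
have tN0 : 0 <= - t by rewrite oppr_ge0 ltW.
rewrite (ltr0_norm t0) -[in f _](opprK t); apply/andP; split.
  apply: (exp_bound_half a0 _ (hN _ _ (hR _ _ hf))) => //.
    by rewrite !oppr0 f0 oppr0.
  by move=> s; rewrite opprK -(normrN s).
apply: (exp_bound_half a0 _ (hR _ _ hf)) => //; first by rewrite oppr0.
by move=> s; rewrite -(normrN s).
Qed.

Lemma le0_geometric (x C : R) : (forall n, x <= C / 2 ^+ n) -> x <= 0.
Proof.
move=> h; have l : (C / 2 ^+ n @[n --> \oo]) --> (0 : R).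
  rewrite (_ : (fun n => _) = geometric C (2^-1)); last first.
    by apply/funext => n /=; rewrite exprVn.
  by apply: cvg_geometric; rewrite ger0_norm ?invf_lt1 ?ltr1n.
have <- := cvg_lim (@Rhausdorff R) l.
by apply: limr_ge; [exact: cvgP l|exact: nearW].
Qed.

End RealCalculus.

Section ContinuousFunctions.
Context {R : realType} {T : topologicalType}.
Implicit Types f g : T -> R.

Lemma continuous_mul f g : continuous f -> continuous g ->
  continuous (fun x => f x * g x).
Proof. by move=> cf cg x; apply: cvgM; [exact: cf|exact: cg]. Qed.

Lemma continuous_sub f g : continuous f -> continuous g ->
  continuous (fun x => f x - g x).
Proof. by move=> cf cg x; apply: cvgB; [exact: cf|exact: cg]. Qed.

Lemma continuous_opp f : continuous f -> continuous (fun x => - f x).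
Proof. by move=> cf x; apply: cvgN; exact: cf. Qed.

End ContinuousFunctions.

(** * Coordinatewise limits and completeness for row vectors *)

Section RowVectorLimits.
Context {R : realType} {m : nat}.

(** The filter may be improper: the punctured filter within the interval of a [solution] is trivial
    at an isolated point, as for [[0, tauN]] with [tauN = 0]. *)
Lemma rV_cvg (T : Type) (F : set_system T) {FF : Filter F}
    (X : T -> 'rV[R]_m) (l : 'rV[R]_m) :
  (forall i, X s 0 i @[s --> F] --> l 0 i) -> X s @[s --> F] --> l.
Proof.
move=> h; apply/cvgrPdist_le => e e0; near=> s.
apply: rV_norm_le; first exact: ltW.
move=> i; rewrite !mxE; move: i; near: s; apply: filter_forall => i.
by have /cvgrPdist_le := h i; apply.
Unshelve. all: by end_near. Qed.

Lemma rV_cvg_coord (T : Type) (F : set_system T) {FF : Filter F}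
    (X : T -> 'rV[R]_m) (l : 'rV[R]_m) i :
  X s @[s --> F] --> l -> X s 0 i @[s --> F] --> l 0 i.
Proof.
move=> /cvgrPdist_le h; apply/cvgrPdist_le => e /h; apply: filterS => s.
by apply: le_trans; have := coord_le_norm (l - X s) i; rewrite !mxE.
Qed.

Lemma rV_continuous (T : topologicalType) (X : T -> 'rV[R]_m) :
  (forall i, continuous (fun s => X s 0 i)) -> continuous X.
Proof. by move=> h s; apply: rV_cvg => i; exact: h. Qed.

Lemma rV_continuous_coord (T : topologicalType) (X : T -> 'rV[R]_m) i :
  continuous X -> continuous (fun s => X s 0 i).
Proof. by move=> h s; apply: rV_cvg_coord; exact: h. Qed.

Lemma lipschitz_continuous (F : 'rV[R]_m -> 'rV[R]_m) (K : R) :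
  (forall u v, `|F u - F v| <= K * `|u - v|) -> continuous F.
Proof.
move=> hF u; apply/(@cvgrPdist_le _ _ _ (nbhs u)) => e e0.
have K0 : 0 < `|K| + 1 by rewrite ltr_wpDl.
near=> v; apply: le_trans (hF _ _) _.
apply: (@le_trans _ _ ((`|K| + 1) * `|u - v|)).
  by rewrite ler_wpM2r// (le_trans (ler_norm _))// lerDl.
rewrite -ler_pdivlMl// mulrC; near: v.
have := @cvg_id _ (nbhs u); move=> /cvgrPdist_le; apply; rewrite divr_gt0.
Unshelve. all: by end_near. Qed.

Lemma geometric_increments (u : nat -> 'rV[R]_m) (C : R) :
  (forall n, `|u n.+1 - u n| <= C / 2 ^+ n) ->
  exists l, forall n, `|l - u n| <= 2 * C / 2 ^+ n.
Proof.
move=> hu.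
have C0 : 0 <= C by have := hu 0; rewrite expr0 divr1; apply: le_trans.
have pow0 n : 0 < 2 ^+ n :> R by rewrite exprn_gt0.
have hk n k : `|u (n + k)%N - u n| <= 2 * C / 2 ^+ n.
  (* Subtracting the tail of the geometric series makes the bound telescope in the induction on
     k. *)
  suff : `|u (n + k)%N - u n| <= 2 * C / 2 ^+ n - 2 * C / 2 ^+ (n + k).
    by move=> h; apply: le_trans h _; rewrite gerBl// divr_ge0 ?mulr_ge0// ltW.
  elim: k => [|k IH]; first by rewrite addn0 !subrr normr0.
  rewrite addnS -(subrKA (u (n + k)%N)) (le_trans (ler_normD _ _))//.
  have := lerD (hu (n + k)%N) IH => /le_trans; apply.
  rewrite exprS invfM mulrA [2 * C]mulrC mulfK//.
  lra.
have geo0 : (2 * C / 2 ^+ n @[n --> \oo]) --> (0 : R).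
  rewrite (_ : (fun n => _) = geometric (2 * C) (2^-1)); last first.
    by apply/funext => n /=; rewrite exprVn.
  by apply: cvg_geometric; rewrite ger0_norm ?invf_lt1 ?ltr1n.
have cu : cvg (u @ \oo).
  apply: cauchy_cvg; apply: cauchy_exP => e e0.
  have /cvgrPdist_lt/(_ _ e0)[N _ hN] := geo0.
  exists (u N); exists N => // k /= Nk; rewrite -ball_normE/= distrC.
  rewrite -(subnKC Nk) (le_lt_trans (hk _ _))//.
  apply: le_lt_trans (ler_norm _) _.
  by have := hN N (leqnn N); rewrite /= sub0r normrN.
exists (lim (u @ \oo)) => n; apply/ler_addgt0Pr => e e0.
have /cvgrPdist_le/(_ _ e0)[N _ hN] := cu.
rewrite -(subrKA (u (n + N)%N)) (le_trans (ler_normD _ _))// addrC lerD//.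
by apply: hN; rewrite /= leq_addl.
Qed.

End RowVectorLimits.

(** * Ordinary differential equations *)

Section OrdinaryDifferentialEquations.
Context {R : realType} {m : nat}.
Implicit Types (F G : 'rV[R]_m -> 'rV[R]_m).

(* Picard iteration converges on the whole line in the norm weighted by
   exp(-2K|t|), in which the integral operator is a contraction of ratio 1/2. *)
Lemma picard G (K : R) (x0 : 'rV[R]_m) :
  (forall u v, `|G u - G v| <= K * `|u - v|) ->
  exists X : R -> 'rV[R]_m, X 0 = x0 /\
    forall (t : R) i, is_derive t 1 (fun s => X s 0 i) (G (X t) 0 i).
Proof.
wlog K0 : K / 0 < K.
  move=> wl hG; apply: (wl (`|K| + 1)); first by rewrite ltr_wpDl.
  move=> u v; apply: le_trans (hG u v) _.
  by rewrite ler_wpM2r// (le_trans (ler_norm _))// lerDl.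
move=> hG; have cG := lipschitz_continuous hG.
pose a := 2 * K; have a0 : 0 < a by rewrite mulr_gt0.
pose P (X : R -> 'rV[R]_m) t :=
  x0 + \row_i primitive (fun s => G (X s) 0 i) t.
have cGX (X : R -> 'rV[R]_m) i : continuous X -> continuous (fun s => G (X s) 0 i).
  move=> cX; apply: rV_continuous_coord => s.
  by apply: continuous_comp; [exact: cX|exact: cG].
have dP X (t : R) i : continuous X ->
    is_derive t 1 (fun s => P X s 0 i) (G (X t) 0 i).
  move=> cX; have hp := is_derive_primitive t (cGX X i cX).
  have := is_derive_add (is_derive_cst (x0 0 i) t 1) hp.
  rewrite add0r; congr (is_derive _ _ _ _).
  by apply/funext => s; rewrite !mxE.
have cP X : continuous X -> continuous (P X).
  by move=> cX; apply: rV_continuous => i t; exact: is_derive_continuous (dP X t i cX).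
have P0 X : P X 0 = x0.
  by apply/rowP => i; rewrite !mxE primitive0 addr0.
have dPB X Z C : continuous X -> continuous Z ->
    (forall t, `|X t - Z t| <= C * expR (a * `|t|)) ->
    forall t, `|P X t - P Z t| <= C / 2 * expR (a * `|t|).
  move=> cX cZ h t.
  have C0 : 0 <= C.
    by have := h 0; rewrite normr0 mulr0 expR0 mulr1; apply: le_trans.
  apply: rV_norm_le => [|i]; first by rewrite mulr_ge0 ?divr_ge0 ?expR_ge0.
  rewrite [_ 0 i](_ : _ = P X t 0 i - P Z t 0 i); last by rewrite !mxE.
  (* The Lipschitz constant contributes K and integration 1/a; the choice a = 2K gives the ratio
     1/2. *)
  rewrite (_ : C / 2 = K * C / a); last by rewrite /a; field; rewrite gt_eqF.
  apply: (@exp_bound _ (fun s => P X s 0 i - P Z s 0 i)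
    (fun s => G (X s) 0 i - G (Z s) 0 i)) => //.
  - by rewrite !P0 subrr.
  - by move=> s; apply: is_derive_sub; exact: dP.
  - move=> s; apply: (@le_trans _ _ `|G (X s) - G (Z s)|).
      by have := coord_le_norm (G (X s) - G (Z s)) i; rewrite !mxE.
    by rewrite (le_trans (hG _ _))// -mulrA ler_wpM2l// ltW.
pose X_ n := iter n P (cst x0).
have cX_ n : continuous (X_ n).
  by elim: n => [|n IH]; [exact: cst_continuous|exact: cP].
(* The first increment has constant derivative [G x0], bounded by |G x0| exp(a|t|). *)
pose A := `|G x0| / a.
have incr n t : `|X_ n.+1 t - X_ n t| <= A * expR (a * `|t|) / 2 ^+ n.
  elim: n t => [|n IH] t.
    rewrite expr0 divr1; apply: rV_norm_le => [|i].
      by rewrite mulr_ge0 ?divr_ge0 ?expR_ge0// ltW.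
    rewrite [_ 0 i](_ : _ = P (cst x0) t 0 i - x0 0 i); last by rewrite !mxE.
    apply: (@exp_bound _ (fun s => P (cst x0) s 0 i - x0 0 i)
      (fun s => G x0 0 i - 0)) => //.
    + by rewrite P0 subrr.
    + move=> s; apply: is_derive_sub.
      by apply: (dP (cst x0)); exact: cst_continuous.
    + move=> s; rewrite subr0 (le_trans (coord_le_norm _ _))//.
      by rewrite ler_peMr// -expR0 ler_expR mulr_ge0// ltW.
  have -> : A * expR (a * `|t|) / 2 ^+ n.+1 = A / 2 ^+ n / 2 * expR (a * `|t|).
    by rewrite exprS invfM; ring.
  apply: (dPB (X_ n.+1) (X_ n)) => // s.
  by rewrite mulrAC; exact: IH.
have /choice[X hX] : forall t, exists l, forall n,
    `|l - X_ n t| <= 2 * (A * expR (a * `|t|)) / 2 ^+ n.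
  by move=> t; apply: geometric_increments => n; exact: incr.
have hX' n t : `|X t - X_ n t| <= 2 * A / 2 ^+ n * expR (a * `|t|).
  by apply: le_trans (hX t n) _; rewrite le_eqVlt; apply/orP; left; apply/eqP; ring.
have A0 : 0 <= A by rewrite divr_ge0// ltW.
clearbody A.
have cX : continuous X.
  move=> t; apply/(@cvgrPdist_le _ _ _ (nbhs t)) => e e0.
  (* [B] dominates the weight for |s| <= |t| + 1; convergence is uniform there, which allows an e/3
     argument. *)
  pose B := 2 * A * expR (a * (`|t| + 1)).
  have B0 : 0 <= B by rewrite mulr_ge0 ?expR_ge0// mulr_ge0.
  have [n hn] : exists n, B / 2 ^+ n <= e / 3.
    apply: contrapT => /forallNP h.
    have /le0_geometric : forall n, e / 3 <= B / 2 ^+ n.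
      by move=> n; have := h n; move/negP; rewrite -ltNge => /ltW.
    by rewrite leNgt divr_gt0.
  have near_X s : `|s| <= `|t| + 1 -> `|X s - X_ n s| <= e / 3.
    move=> st; apply: le_trans (hX' n s) _; apply: le_trans _ hn.
    have A2 : 0 <= 2 * A / 2 ^+ n by apply: divr_ge0; rewrite ?exprn_ge0 ?mulr_ge0.
    rewrite /B [leRHS]mulrAC; apply: ler_wpM2l => //.
    by rewrite ler_expR ler_wpM2l// ltW.
  near=> s.
  have st : `|s| <= `|t| + 1.
    rewrite -lerBlDl (le_trans (lerB_dist _ _))// distrC; near: s.
  have -> : X t - X s = (X t - X_ n t) + (X_ n t - X_ n s) - (X s - X_ n s).
    by rewrite addrA subrK opprB addrA subrK.
  rewrite (le_trans (ler_normB _ _))// (_ : e = e / 3 + e / 3 + e / 3); last by field.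
  rewrite lerD ?near_X// (le_trans (ler_normD _ _))// lerD ?near_X ?lerDl//.
  near: s; have /cvgrPdist_le := cX_ n t; apply; exact: divr_gt0.
have PX t : P X t = X t.
  apply/eqP; rewrite -subr_eq0 -normr_le0; apply/eqP.
  apply/eqP; apply: (@le0_geometric _ _ (2 * (A * expR (a * `|t|)))) => n.
  (* [P X] and [X] are both within A exp(a|t|) / 2^n of the iterate [X_ n.+1 = P (X_ n)]. *)
  have h1 := dPB _ _ _ cX (cX_ n) (hX' n) t.
  have h2 := hX' n.+1 t.
  rewrite -(subrKA (X_ n.+1 t)) (le_trans (ler_normD _ _))// [`|_ - X t|]distrC.
  apply: le_trans (lerD h1 h2) _.
  rewrite le_eqVlt; apply/orP; left; apply/eqP; rewrite exprS; field.
  by rewrite gt_eqF ?exprn_gt0.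
exists X; split; first by rewrite -PX P0.
move=> t i; have := dP X t i cX.
by congr (is_derive _ _ _ _); apply/funext => s; rewrite PX.
Unshelve. all: by end_near. Qed.

Lemma is_derive_dotp (u v : R -> 'rV[R]_m) (t : R) (du dv : 'rV[R]_m) :
  (forall i, is_derive t 1 (fun s => u s 0 i) (du 0 i)) ->
  (forall i, is_derive t 1 (fun s => v s 0 i) (dv 0 i)) ->
  is_derive t 1 (fun s => dotp (u s) (v s)) (dotp du (v t) + dotp (u t) dv).
Proof.
move=> hu hv; rewrite /dotp -big_split /=; apply: is_derive_big => i.
exact: is_derive_mul.
Qed.

(* Gronwall for |u - v|^2. *)
Lemma ode_unique F (K b : R) (u v : R -> 'rV[R]_m) :
  (forall t, 0 <= t <= b -> `|F (u t) - F (v t)| <= K * `|u t - v t|) ->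
  (forall i, {within `[0, b], continuous (fun t => u t 0 i)}) ->
  (forall i, {within `[0, b], continuous (fun t => v t 0 i)}) ->
  (forall (t : R) i, 0 < t < b -> is_derive t 1 (fun s => u s 0 i) (F (u t) 0 i)) ->
  (forall (t : R) i, 0 < t < b -> is_derive t 1 (fun s => v s 0 i) (F (v t) 0 i)) ->
  u 0 = v 0 -> forall t, 0 <= t <= b -> u t = v t.
Proof.
move=> hF cu cv du dv uv0 t /andP[t0 tb].
pose w s := dotp (u s - v s) (u s - v s).
pose D s := F (u s) - F (v s).
have dw s : 0 < s < b -> is_derive s 1 w (2 * dotp (D s) (u s - v s)).
  move=> sb.
  have duv i : is_derive s 1 (fun r => (u r - v r) 0 i) (D s 0 i).
    rewrite (_ : (fun r => _) = fun r => u r 0 i - v r 0 i); last first.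
      by apply/funext => r; rewrite !mxE.
    by rewrite !mxE; apply: is_derive_sub; [exact: du|exact: dv].
  by rewrite mulrDl !mul1r [X in _ + X]dotpC; exact: is_derive_dotp.
(* The Lipschitz bound is in the sup norm and [w] is Euclidean: the factor m pays for the
   conversion, the factor 2 comes from differentiating a square. *)
pose c := 2 * (m%:R * `|K|).
have Dle s : 0 < s < b -> 2 * dotp (D s) (u s - v s) <= c * w s.
  move=> /andP[s0 sb]; rewrite /c -mulrA ler_wpM2l//.
  apply: le_trans (ler_norm _) _; apply: le_trans (dotp_le _ _) _.
  rewrite /w -sqr_enorm expr2 mulrA ler_wpM2r ?enorm_ge0//.
  apply: le_trans (enorm_le_norm _) _; rewrite -mulrA ler_wpM2l//.
  have sb' : 0 <= s <= b by rewrite !ltW.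
  apply: le_trans (hF s sb') _.
  apply: (@le_trans _ _ (`|K| * `|u s - v s|)).
    by rewrite ler_wpM2r// ler_norm.
  by rewrite ler_wpM2l// norm_le_enorm.
have cw : {within `[0, b], continuous w}.
  rewrite (_ : w = fun s => \sum_i (u s 0 i - v s 0 i) * (u s 0 i - v s 0 i)).
    apply: sum_continuous => i.
    by apply: continuous_mul; apply: continuous_sub; [exact: cu|exact: cv|exact: cu|exact: cv].
  by apply/funext => s; apply: eq_bigr => i _; rewrite !mxE.
(* exp(-c t) w is nonincreasing; the minus sign turns this into a nondecreasing function that
   vanishes at 0 and is never positive. *)
have : expR (- c * 0) * - w 0 <= expR (- c * t) * - w t.
  apply: (@nondecreasing_itv _ (fun s => expR (- c * s) * - w s)
    (fun s => (- c * expR (- c * s)) * - w s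
      + expR (- c * s) * - (2 * dotp (D s) (u s - v s)))).
  - exact: t0.
  - move=> s /andP[s0 st]; apply: is_derive_mul; first exact: is_derive_expRM.
    by apply: is_deriveN; apply: dw; rewrite s0 (lt_le_trans st).
  - move=> s /andP[s0 st].
    have /Dle h : 0 < s < b by rewrite s0 (lt_le_trans st).
    rewrite (_ : _ + _ = expR (- c * s) * (c * w s - 2 * dotp (D s) (u s - v s))).
      by rewrite mulr_ge0 ?expR_ge0// subr_ge0.
    by ring.
  - apply: continuous_mul; last first.
      apply: continuous_opp; apply: continuous_subspaceW cw => r /=.
      by rewrite !in_itv/= => /andP[-> /le_trans]; apply.
    by apply: continuous_subspaceT => r; exact: is_derive_continuous (is_derive_expRM _ _).
rewrite {1}/w uv0 subrr dotp0l oppr0 mulr0 pmulr_rge0 ?expR_gt0// oppr_ge0 => wt.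
by apply/eqP; rewrite -subr_eq0; apply/eqP/dotp_eq0/le_anti; rewrite wt dotp_ge0.
Qed.

Lemma dnbhs_shift (P : set R) t :
  (\forall h \near 0^', P (h + t)) <-> \forall s \near t^', P s.
Proof.
rewrite /dnbhs !near_withinE.
have := near_shift 0 t (fun s => s != t -> P s); rewrite subr0 => E.
split=> h; [suff: \forall s \near t, s != t -> P s by []; rewrite E|move: h;
  rewrite [X in X -> _](_ : _ = \forall s \near t, s != t -> P s)// E => h];
by apply: filterS h => h /=; rewrite -(subr_eq0 _ t) addrK.
Qed.

(** Translates between derivatives taken at increments h near 0 and the quotients in s near t used
    by [solution]. *)
Lemma is_derive_quotientP (f : R -> R) (t l : R) :
  is_derive t 1 f l <-> (s - t)^-1 * (f s - f t) @[s --> t^'] --> l.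
Proof.
have E : (h^-1 *: ((f \o shift t) (h *: 1) - f t) @[h --> 0^'] --> l) <->
    ((s - t)^-1 * (f s - f t) @[s --> t^'] --> l).
  split=> /cvgrPdist_le h; apply/cvgrPdist_le => e /h.
    move=> h1; apply/dnbhs_shift; move: h1; apply: filterS => s.
    by rewrite /= addrK [_%:A]mulr1.
  move=> /dnbhs_shift; apply: filterS => s.
  by rewrite /= addrK [_%:A]mulr1.
split=> [[/cvg_ex[l' h1] dl]|/E h].
  by apply/E; rewrite -(_ : l' = l)// -dl; apply/esym/cvg_lim.
by apply: DeriveDef; [apply/cvg_ex; exists l|exact: cvg_lim].
Qed.

(* One-sided derivatives at the endpoints of I are all that [solution] gives. *)
Lemma solution_is_derive F (I : set R) (y : R -> 'rV[R]_m) (t : R) i :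
  solution F I y -> nbhs t I -> is_derive t 1 (fun s => y s 0 i) (F (y t) 0 i).
Proof.
move=> [hy _] It; apply/is_derive_quotientP.
have FF : Filter (within I t^') by exact: within_filter.
have := @rV_cvg_coord _ _ _ (within I t^') FF _ _ i (hy t (nbhs_singleton It)).
rewrite (_ : (fun s => _) = fun s => (s - t)^-1 * (y s 0 i - y t 0 i)); last first.
  by apply/funext => s; rewrite !mxE.
move=> /cvgrPdist_le h; apply/cvgrPdist_le => e /h; rewrite !near_withinE.
rewrite !near_simpl => hI; near=> s => st; apply: (near hI s) => //.
by apply: (near It).
Unshelve. all: by end_near. Qed.

(** [solution] only asks that F composed with y be continuous. Continuity of y comes from its
    difference quotients, which are bounded by |l| + 1 near t. *)
Lemma solution_continuous F (I : set R) (y : R -> 'rV[R]_m) i :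
  solution F I y -> {within I, continuous (fun s => y s 0 i)}.
Proof.
move=> [hy _]; apply/subspace_continuousP => t It.
have FF : Filter (within I t^') by exact: within_filter.
have := @rV_cvg_coord _ _ _ (within I t^') FF _ _ i (hy t It).
rewrite (_ : (fun s => _) = fun s => (s - t)^-1 * (y s 0 i - y t 0 i)); last first.
  by apply/funext => s; rewrite !mxE.
move=> /cvgrPdist_le/(_ 1 ltr01); rewrite !near_withinE => h.
apply/cvgrPdist_le => e e0; rewrite !near_withinE.
set l := F (y t) 0 i in h.
have l0 : 0 < `|l| + 1 by rewrite ltr_wpDl.
have h' : \forall s \near t, `|t - s| <= e / (`|l| + 1).
  by have := @cvg_id _ (nbhs t) => /cvgrPdist_le; apply; rewrite divr_gt0.
near=> s => Is; have [->|st] := eqVneq s t; first by rewrite subrr normr0 ltW.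
have q1 : `|l - (s - t)^-1 * (y s 0 i - y t 0 i)| <= 1.
  by move: Is; apply: (near h s).
have st0 : s - t != 0 by rewrite subr_eq0.
rewrite distrC -[y s 0 i - _](mulVKf st0) normrM.
apply: (@le_trans _ _ (e / (`|l| + 1) * (`|l| + 1))); last by rewrite divfK ?gt_eqF.
apply: ler_pM => //; first by rewrite distrC; apply: (near h' s).
rewrite -lerBlDl (le_trans _ q1)// distrC; exact: lerB_dist.
Unshelve. all: by end_near. Qed.

Lemma is_derive_solution F (I : set R) (y Fy : R -> 'rV[R]_m) :
  (forall (t : R) i, I t -> is_derive t 1 (fun s => y s 0 i) (F (y t) 0 i)) ->
  {within I, continuous Fy} -> (forall t, I t -> F (y t) = Fy t) ->
  solution F I y.
Proof.
move=> dy cF FE; split; last first.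
  apply: subspace_eq_continuous cF => t; rewrite inE => It.
  exact/esym/FE.
move=> t It; apply: rV_cvg => i.
rewrite (_ : (fun s => _) = fun s => (s - t)^-1 * (y s 0 i - y t 0 i)); last first.
  by apply/funext => s; rewrite !mxE.
have /is_derive_quotientP := dy t i It.
by move=> h; apply: cvg_trans h; apply: cvg_app; exact: cvg_within.
Qed.

End OrdinaryDifferentialEquations.

(** * Polynomial vector fields and their normalization *)

Section LocallyLipschitz.
Context {R : realType} {m : nat}.
Implicit Types phi psi : 'rV[R]_m -> R.

(** The sup bound is bundled with the Lipschitz bound because the product rule needs both. *)
Definition lipschitz_on_balls phi := forall M : R, exists C, [/\ 0 <= C,
  forall u, `|u| <= M -> `|phi u| <= C &
  forall u v, `|u| <= M -> `|v| <= M -> `|phi u - phi v| <= C * `|u - v|].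

Lemma lipschitz_on_balls_cst (c : R) : lipschitz_on_balls (fun=> c).
Proof. by move=> M; exists `|c|; split=> // u v _ _; rewrite subrr normr0 mulr_ge0. Qed.

Lemma lipschitz_on_balls_coord i : lipschitz_on_balls (fun u => u 0 i).
Proof.
move=> M; exists (`|M| + 1); split=> [|u uM|u v _ _]; first by rewrite addr_ge0.
  rewrite (le_trans (coord_le_norm _ _))// (le_trans uM)//.
  by rewrite (le_trans (ler_norm _))// lerDl.
apply: (@le_trans _ _ `|u - v|).
  by have := coord_le_norm (u - v) i; rewrite !mxE.
by rewrite ler_peMl// lerDr.
Qed.

Lemma lipschitz_on_ballsD phi psi : lipschitz_on_balls phi ->
  lipschitz_on_balls psi -> lipschitz_on_balls (fun u => phi u + psi u).
Proof.
move=> hphi hpsi M; have [C [C0 bC lC]] := hphi M; have [D [D0 bD lD]] := hpsi M.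
exists (C + D); split=> [|u uM|u v uM vM]; first exact: addr_ge0.
  by rewrite (le_trans (ler_normD _ _))// lerD ?bC ?bD.
rewrite opprD addrACA (le_trans (ler_normD _ _))// mulrDl.
by rewrite lerD ?lC ?lD.
Qed.

Lemma lipschitz_on_ballsM phi psi : lipschitz_on_balls phi ->
  lipschitz_on_balls psi -> lipschitz_on_balls (fun u => phi u * psi u).
Proof.
move=> hphi hpsi M; have [C [C0 bC lC]] := hphi M; have [D [D0 bD lD]] := hpsi M.
exists (2 * (C * D) + C * D); split=> [|u uM|u v uM vM].
- by rewrite addr_ge0// !mulr_ge0.
- rewrite normrM (@le_trans _ _ (C * D))// ?ler_pM ?bC ?bD//.
  by rewrite lerDr !mulr_ge0.
have -> : phi u * psi u - phi v * psi v =
    phi u * (psi u - psi v) + (phi u - phi v) * psi v by ring.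
rewrite (le_trans (ler_normD _ _))// !normrM.
apply: (@le_trans _ _ (C * (D * `|u - v|) + (C * `|u - v|) * D)).
  by rewrite lerD// ler_pM ?bC ?bD ?lC ?lD ?mulr_ge0.
have : 0 <= C * D * `|u - v| by rewrite !mulr_ge0.
by rewrite !mulrDl; lra.
Qed.

Lemma lipschitz_on_balls_sum (I : Type) (r : seq I) (F : I -> 'rV[R]_m -> R) :
  (forall i, lipschitz_on_balls (F i)) ->
  lipschitz_on_balls (fun u => \sum_(i <- r) F i u).
Proof.
move=> hF; elim: r => [|i r IH].
  rewrite (_ : (fun u => _) = fun=> 0); first exact: lipschitz_on_balls_cst.
  by apply/funext => u; rewrite big_nil.
rewrite (_ : (fun u => _) = fun u => F i u + \sum_(j <- r) F j u).
  exact: lipschitz_on_ballsD.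
by apply/funext => u; rewrite big_cons.
Qed.

Lemma lipschitz_on_balls_prod (I : Type) (r : seq I) (F : I -> 'rV[R]_m -> R) :
  (forall i, lipschitz_on_balls (F i)) ->
  lipschitz_on_balls (fun u => \prod_(i <- r) F i u).
Proof.
move=> hF; elim: r => [|i r IH].
  rewrite (_ : (fun u => _) = fun=> 1); first exact: lipschitz_on_balls_cst.
  by apply/funext => u; rewrite big_nil.
rewrite (_ : (fun u => _) = fun u => F i u * \prod_(j <- r) F j u).
  exact: lipschitz_on_ballsM.
by apply/funext => u; rewrite big_cons.
Qed.

Lemma lipschitz_on_balls_meval (p : mpoly m R) :
  lipschitz_on_balls (fun u => meval (fun j => u 0 j) p).
Proof.
rewrite (_ : (fun u => _) = fun u : 'rV[R]_m =>
    \sum_(k <- msupp p) mcoeff k p * \prod_i \prod_(j < k i) u 0 i); last first.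
  apply/funext => u; rewrite mevalE; apply: eq_bigr => k _; congr (_ * _).
  by apply: eq_bigr => i _; rewrite prodr_const card_ord.
apply: lipschitz_on_balls_sum => k; apply: lipschitz_on_ballsM.
  exact: lipschitz_on_balls_cst.
apply: lipschitz_on_balls_prod => i; apply: lipschitz_on_balls_prod => j.
exact: lipschitz_on_balls_coord.
Qed.

Lemma vfield_lipschitz (f : 'I_m -> mpoly m R) (M : R) : exists C, [/\ 0 <= C,
  forall u, `|u| <= M -> `|vfield f u| <= C &
  forall u v, `|u| <= M -> `|v| <= M -> `|vfield f u - vfield f v| <= C * `|u - v|].
Proof.
have /choice[C hC] := fun i => lipschitz_on_balls_meval (f i) M.
have C0 i : 0 <= C i by case: (hC i).
have Cle i : C i <= \sum_j C j by rewrite (bigD1 i)//= lerDl sumr_ge0.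
have S0 : 0 <= \sum_j C j by rewrite sumr_ge0.
exists (\sum_i C i); split=> // [u uM|u v uM vM].
  apply: rV_norm_le => // i; rewrite !mxE; have [_ h _] := hC i.
  exact: le_trans (h u uM) (Cle i).
apply: rV_norm_le => [|i]; first by rewrite mulr_ge0.
rewrite !mxE; have [_ _ h] := hC i.
by apply: le_trans (h u v uM vM) _; rewrite ler_wpM2r.
Qed.

Lemma vfield_continuous (f : 'I_m -> mpoly m R) : continuous (vfield f).
Proof.
move=> u; have [C [C0 _ lC]] := vfield_lipschitz f (`|u| + 1).
apply/(@cvgrPdist_le _ _ _ (nbhs u)) => e e0.
have C1 : 0 < C + 1 by rewrite ltr_wpDl.
near=> v.
have uv1 : `|u - v| <= 1.
  by near: v; have := @cvg_id _ (nbhs u) => /cvgrPdist_le; apply.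
have v1 : `|v| <= `|u| + 1.
  by rewrite -lerBlDl (le_trans (lerB_dist _ _))// distrC.
apply: le_trans (lC u v _ v1) _; first by rewrite lerDl.
apply: (@le_trans _ _ ((C + 1) * `|u - v|)); first by rewrite ler_wpM2r// lerDl.
rewrite -ler_pdivlMl// mulrC; near: v.
have := @cvg_id _ (nbhs u) => /cvgrPdist_le; apply; exact: divr_gt0.
Unshelve. all: by end_near. Qed.

Lemma meval_homog (p : mpoly m R) (j : nat) (c : R) (u : 'rV[R]_m) :
  meval (fun i => (c *: u) 0 i) (pihomog (@mdeg m) j p) =
  c ^+ j * meval (fun i => u 0 i) (pihomog (@mdeg m) j p).
Proof.
rewrite !mevalE mulr_sumr; apply: eq_big_seq => k kp.
have /dhomogP/(_ k kp)/= kj := pihomogP (@mdeg m) j p.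
rewrite mulrCA; congr (_ * _); rewrite -kj mdegE -prodrXr -big_split /=.
by apply: eq_bigr => i _; rewrite mxE exprMn.
Qed.

End LocallyLipschitz.

Section NormalizedFieldOnBall.
Context {R : realType} {m : nat}.
Implicit Types (f : 'I_m -> mpoly m R) (x : 'rV[R]_m).

(* The inverse of kappa in terms of x = T(y). *)
Definition rho x : R := Num.sqrt (1 - enorm x ^+ 2).

(** For a = n = 0 both sides are 1, so the top-degree term survives on the sphere. *)
Lemma powR_half (a : R) (n : nat) : 0 <= a -> a `^ (n%:R / 2) = Num.sqrt a ^+ n.
Proof.
by move=> a0; rewrite mulrC powRrM powR12_sqrt// powR_mulrn// sqrtr_ge0.
Qed.

Lemma cdisc_sub_ge0 x : cdisc x -> 0 <= 1 - enorm x ^+ 2.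
Proof. by move=> x1; rewrite subr_ge0 expr_le1// enorm_ge0. Qed.

Lemma disc_sub_gt0 x : disc x -> 0 < 1 - enorm x ^+ 2.
Proof. by move=> x1; rewrite subr_gt0 expr_lt1// enorm_ge0. Qed.

Lemma disc_cdisc x : disc x -> cdisc x.
Proof. exact: ltW. Qed.

Lemma rho_gt0 x : disc x -> 0 < rho x.
Proof. by move=> /disc_sub_gt0 x1; rewrite sqrtr_gt0. Qed.

Lemma rho_le1 x : rho x <= 1.
Proof. by rewrite -[leRHS]sqrtr1 ler_wsqrtr// gerBl sqr_ge0. Qed.

Lemma ftildeE f d x : cdisc x ->
  ftilde f d x = \sum_(j < d.+1) rho x ^+ (d - j) *: vfield (homog_part f j) x.
Proof.
move=> /cdisc_sub_ge0 x1; apply: eq_bigr => j _; congr (_ *: _).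
by rewrite powR_half.
Qed.

(** The identity ftilde(x) = kappa^(-d) f(kappa x), with kappa = 1/rho: homogeneity of degree j
    turns rho^(d-j) into rho^d kappa^j. *)
Lemma ftilde_scale f d x : vdegree f d -> disc x ->
  ftilde f d x = rho x ^+ d *: vfield f ((rho x)^-1 *: x).
Proof.
move=> fd xd; have r0 := rho_gt0 xd; rewrite ftildeE; last exact: disc_cdisc.
apply/rowP => i; rewrite summxE !mxE.
(* [mmeasure] exceeds the degree by one, which matches the [d.+1] homogeneous parts summed in
   [ftilde]. *)
have fi : (mmeasure (@mdeg m) (f i) <= d.+1)%N by rewrite -fd leq_bigmax.
rewrite [in RHS](pihomog_partitionE fi) raddf_sum mulr_sumr.
apply: eq_bigr => j _; rewrite !mxE /= meval_homog mulrA; congr (_ * _).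
have jd : (j <= d)%N by rewrite -ltnS.
by rewrite -[X in _ ^+ X * _](subnK jd) exprD -mulrA -exprMn divff ?gt_eqF// expr1n mulr1.
Qed.

(** Supplies the constant of the inequality |z'| <= C |z|: since rho <= 1, the weights of the
    homogeneous parts stay bounded up to the sphere. *)
Lemma ftilde_bounded f d : exists C, 0 <= C /\
  forall x, cdisc x -> `|dotp x (ftilde f d x)| <= C.
Proof.
have /choice[C hC] := fun j : 'I_d.+1 => vfield_lipschitz (homog_part f j) 1.
have C0 j : 0 <= C j by case: (hC j).
exists (m%:R * \sum_j C j); split; first by rewrite mulr_ge0// sumr_ge0.
move=> x x1; apply: le_trans (dotp_le _ _) _.
apply: (@le_trans _ _ (1 * enorm (ftilde f d x))).
  by rewrite ler_wpM2r// enorm_ge0.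
rewrite mul1r (le_trans (enorm_le_norm _))// ler_wpM2l// ftildeE//.
apply: le_trans (ler_norm_sum _ _ _) _; apply: ler_sum => j _.
rewrite normrZ -[leRHS]mul1r ler_pM//.
  by rewrite ger0_norm ?exprn_ge0 ?sqrtr_ge0// exprn_ile1 ?sqrtr_ge0 ?rho_le1.
have [_ h _] := hC j; apply: h; exact: le_trans (norm_le_enorm _) x1.
Qed.

(** The factor 1 - |x|^2 makes the sphere invariant and keeps orbits that start inside from reaching
    it in finite time. *)
Lemma dotp_normalized_field f d x :
  dotp x (normalized_field f d x) = dotp x (ftilde f d x) * (1 - enorm x ^+ 2).
Proof.
rewrite /normalized_field -scaleNr dotpDr dotpZr sqr_enorm; ring.
Qed.

End NormalizedFieldOnBall.

(** * Continuity and differentiation along curves *)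

Lemma continuous_within_comp (S T U : topologicalType) (A : set S) (B : set T)
    (h : T -> U) (gam : S -> T) :
  {within A, continuous gam} -> (forall s, A s -> B (gam s)) ->
  {within B, continuous h} -> {within A, continuous (h \o gam)}.
Proof.
move=> /subspace_continuousP cgam AB /subspace_continuousP ch.
apply/subspace_continuousP => s As P hP.
have h1 : \forall r \near s, A r -> B (gam r) -> P (h (gam r)).
  exact: cgam s As _ (ch _ (AB s As) _ hP).
suff : \forall r \near s, A r -> P (h (gam r)) by [].
by apply: filterS h1 => r h1 Ar; exact: h1 Ar (AB r Ar).
Qed.

Section ChainRule.
Context {R : realType} {m : nat}.

Lemma is_derive_rV n (gam : R -> 'rV[R]_n) (s : R) (dgam : 'rV[R]_n) :
  is_derive s 1 gam dgam <->
  forall i, is_derive s 1 (fun r => gam r 0 i) (dgam 0 i).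
Proof.
split=> [[dg <-] i|h].
  have /derivable_mxP/(_ 0 i) := dg; rewrite derive_mx// mxE.
  exact: derivableP.
have dg : derivable gam s 1.
  by apply/derivable_mxP => i j; rewrite ord1; case: (h j).
apply: DeriveDef => //; rewrite derive_mx//; apply/rowP => i; rewrite mxE.
by case: (h i).
Qed.

Lemma is_derive_diff_comp (W : normedModType R) (phi : 'rV[R]_m -> W)
    (gam : R -> 'rV[R]_m) (s : R) (dgam : 'rV[R]_m) :
  differentiable phi (gam s) -> is_derive s 1 gam dgam ->
  is_derive s 1 (phi \o gam) ('d phi (gam s) dgam).
Proof.
move=> dphi [/derivable1_diffP dg <-].
have dc : differentiable (phi \o gam) s by exact: differentiable_comp.
apply: DeriveDef; first exact/derivable1_diffP.
by rewrite !deriveE// diff_comp.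
Qed.

End ChainRule.

(** * Lipschitz bounds on the closed ball and the radial retraction *)

Section LipschitzOnBall.
Context {R : realType} {m : nat}.
Implicit Types (u v x : 'rV[R]_m) (g : 'rV[R]_m -> 'rV[R]_m).

(** Strict convexity, quantified by |u + s(v-u)|^2 = (1-s)|u|^2 + s|v|^2 - s(1-s)|v-u|^2. It allows
    the mean value theorem between two boundary points. *)
Lemma segment_disc u v (s : R) : cdisc u -> cdisc v -> u != v -> 0 < s < 1 ->
  disc (u + s *: (v - u)).
Proof.
move=> u1 v1 uv /andP[s0 s1].
have sq x : cdisc x -> dotp x x <= 1 by move=> x1; rewrite -sqr_enorm expr_le1// enorm_ge0.
have uv0 : 0 < dotp (v - u) (v - u).
  rewrite lt_neqAle dotp_ge0 andbT eq_sym; apply/eqP => /dotp_eq0/eqP.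
  by rewrite subr_eq0 eq_sym (negbTE uv).
rewrite /disc/= -(@ltr_pXn2r _ 2)// ?nnegrE ?enorm_ge0// expr1n sqr_enorm.
have -> : dotp (u + s *: (v - u)) (u + s *: (v - u)) =
    (1 - s) * dotp u u + s * dotp v v - s * (1 - s) * dotp (v - u) (v - u).
  by rewrite !(dotpDl, dotpDr, dotpNl, dotpNr, dotpZl, dotpZr) (dotpC v u); ring.
have h1 : 0 < s * (1 - s) * dotp (v - u) (v - u) by rewrite !mulr_gt0// subr_gt0.
have h2 : (1 - s) * dotp u u <= 1 - s by rewrite ger_pMr ?subr_gt0// sq.
have h3 : s * dotp v v <= s by rewrite ger_pMr// sq.
lra.
Qed.

Lemma segment_cdisc u v (s : R) : cdisc u -> cdisc v -> 0 <= s <= 1 ->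
  cdisc (u + s *: (v - u)).
Proof.
move=> u1 v1 /andP[s0 s1]; rewrite (_ : _ + _ = (1 - s) *: u + s *: v).
  rewrite /cdisc/= (le_trans (enormD _ _))// !enormZ !ger0_norm ?subr_ge0//.
  have h2 : (1 - s) * enorm u <= 1 - s by rewrite ler_piMr// subr_ge0.
  have h3 : s * enorm v <= s by rewrite ler_piMr.
  lra.
by rewrite scalerBr scalerBl scale1r addrAC -addrA.
Qed.

(** [Dg] is bounded by compactness, and the mean value theorem applies to each coordinate of [g]
    along a segment with interior in the open ball. The factor m counts the terms of a row-matrix
    product. *)
Lemma C1_on_cdisc_lipschitz g (Dg : 'rV[R]_m -> 'M[R]_m) : C1_on_cdisc g Dg ->
  exists K, forall u v, cdisc u -> cdisc v -> `|g u - g v| <= K * `|u - v|.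
Proof.
move=> [dg DgE cg cDg].
have [B [B0 hB]] : exists B, 0 <= B /\ forall x, cdisc x -> `|Dg x| <= B.
  have /compact_bounded[M [_ hM]] := continuous_compact cDg compact_cdisc.
  exists (`|M| + 1); split; first by rewrite addr_ge0.
  move=> x x1; apply: (hM (`|M| + 1)); last by exists x.
  by rewrite (le_lt_trans (ler_norm _))// ltrDl.
exists (m%:R * B) => u v u1 v1; have [->|uv] := eqVneq u v.
  by rewrite !subrr !normr0 mulr0.
apply: rV_norm_le => [|i]; first by rewrite !mulr_ge0.
pose gam (s : R) : 'rV[R]_m := u + s *: (v - u).
have dgam (s : R) j : is_derive s 1 (fun r => gam r 0 j) ((v - u) 0 j).
  rewrite (_ : (fun r => _) = fun r => u 0 j + (v - u) 0 j * r); last first.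
    by apply/funext => r; rewrite !mxE mulrC.
  have := is_derive_add (is_derive_cst (u 0 j) s 1)
    (is_derive_scale ((v - u) 0 j) (is_derive_id s 1)).
  by rewrite add0r mulr1.
have cgam : continuous gam.
  by apply: rV_continuous => j s; exact: is_derive_continuous (dgam s j).
have dphi (s : R) : s \in `]0, 1[ ->
    is_derive s 1 (fun r => g (gam r) 0 i) (((v - u) *m Dg (gam s)) 0 i).
  rewrite in_itv/= => s01; have gd := segment_disc u1 v1 uv s01.
  rewrite DgE// -deriveEjacobian; last exact: dg.
  rewrite deriveE; last exact: dg.
  have /is_derive_rV := is_derive_diff_comp (dg _ gd) ((is_derive_rV _ _ _).2 (dgam s)).
  exact.
have cphi : {within `[0, 1], continuous (fun r => g (gam r) 0 i)}.
  apply: rV_continuous_coord; apply: (continuous_within_comp _ _ cg).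
    exact: continuous_subspaceT.
  by move=> s /=; rewrite in_itv/=; exact: segment_cdisc.
have [s s01] := MVT ltr01 dphi cphi.
rewrite /gam scale1r scale0r addr0 subr0 mulr1 [u + _]addrC subrK => gE.
rewrite !mxE distrC. rewrite gE mxE.
apply: le_trans (ler_norm_sum _ _ _) _.
apply: (@le_trans _ _ (\sum_(j < m) B * `|u - v|)); last first.
  by rewrite sumr_const card_ord -mulrA mulr_natl.
apply: ler_sum => j _; rewrite normrM mulrC ler_pM//.
  apply: le_trans (hB (gam s) _); last first.
    by apply/disc_cdisc/segment_disc => //; move: s01; rewrite in_itv.
  rewrite [leRHS]/Num.Def.normr/= mx_normrE.
  exact: (le_bigmax _ (fun p : 'I_m * 'I_m => `|Dg (gam s) p.1 p.2|) (j, i)).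
by rewrite distrC coord_le_norm.
Qed.

Definition retract x : 'rV[R]_m := (Num.max 1 (enorm x))^-1 *: x.

Lemma retract_cdisc x : cdisc (retract x).
Proof.
have m0 : 0 < Num.max 1 (enorm x) by rewrite lt_max ltr01.
rewrite /cdisc/= enormZ gtr0_norm ?invr_gt0// mulrC ler_pdivrMr// mul1r.
by rewrite le_max lexx orbT.
Qed.

Lemma retract_id x : cdisc x -> retract x = x.
Proof. by move=> x1; rewrite /retract max_l// invr1 scale1r. Qed.

Lemma retract_lipschitz u v :
  `|retract u - retract v| <= (2 * m%:R) * `|u - v|.
Proof.
apply: le_trans (norm_le_enorm _) _.
suff : enorm (retract u - retract v) <= 2 * enorm (u - v).
  by move/le_trans; apply; rewrite -mulrA ler_wpM2l// enorm_le_norm.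
pose M x := Num.max 1 (enorm x).
have M1 x : 1 <= M x by rewrite le_max lexx.
have M0 x : 0 < M x by apply: lt_le_trans (M1 x).
have Mlip : `|M v - M u| <= enorm (u - v).
  rewrite distrC; apply: le_trans (enorm_dist u v); rewrite /M.
  have := ler_norm (enorm u - enorm v); have := ler_norm (- (enorm u - enorm v)).
  rewrite normrN ler_norml; set D := `|_| => h1 h2.
  have D0 : 0 <= D by exact: normr_ge0.
  by case: (leP 1 (enorm u)) => hu; case: (leP 1 (enorm v)) => hv; apply/andP; split; lra.
(* The first term rescales u - v by at most 1, the second is the change of the scaling factor,
   controlled by [Mlip]: hence the Euclidean constant 2. *)
have -> : retract u - retract v =
    (M u)^-1 *: (u - v) + ((M v - M u) / (M u * M v)) *: v.
  rewrite scalerBr -addrA -scaleNr -scalerDl; congr (_ + _).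
  by rewrite -scaleNr; congr (_ *: _); rewrite -/(M v); field; rewrite !gt_eqF.
apply: le_trans (enormD _ _) _; rewrite !enormZ.
rewrite [leRHS](_ : _ = enorm (u - v) + enorm (u - v)); last by ring.
rewrite lerD//.
  by rewrite gtr0_norm ?invr_gt0//; rewrite ler_piMl ?enorm_ge0// invf_le1.
rewrite normrM -mulrA -[leRHS]mulr1 ler_pM// ?mulr_ge0 ?enorm_ge0//.
rewrite normfV gtr0_norm ?mulr_gt0// mulrC ler_pdivrMr ?mulr_gt0// mul1r.
apply: (@le_trans _ _ (M v)); first by rewrite le_max lexx orbT.
by rewrite ler_peMl// ltW.
Qed.

End LipschitzOnBall.

(** Induction along the line: the supremum of [A] on [a, s] belongs to [A] by closedness, and [step]
    pushes past it unless it is s. *)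
Lemma right_propagation (R : realType) (A : set R) (a : R) : closed A -> A a ->
  (forall t, a <= t -> A t -> \forall s \near t, t < s -> A s) ->
  forall t, a <= t -> A t.
Proof.
move=> cA Aa step s as_; apply: contrapT => nAs.
pose S := A `&` `[a, s]%classic.
have Sa : S a by split => //=; rewrite in_itv/= lexx.
have ubS : ubound S s by move=> r [_]; rewrite /= in_itv/= => /andP[].
have supS : has_sup S by split; [exists a|exists s].
have cS : closed S by apply: closedI => //; exact: interval_closed.
have : S (sup S) by rewrite {1}(closure_id S).1//; apply: closure_sup; [exists a|exists s].
set t := sup S => -[At]; rewrite /= in_itv/= => /andP[at_ ts].
have {}ts : t < s by rewrite lt_neqAle ts andbT; apply: contra_notN nAs => /eqP <-.
have [e /= e0 he] := step t at_ At.
pose r := Num.min (t + e / 2) s.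
have tr : t < r by rewrite lt_min ts ltrDl divr_gt0.
have Sr : S r.
  split; last by rewrite /= in_itv/= (le_trans at_ (ltW tr)) ge_min lexx orbT.
  apply: he => //=; rewrite distrC gtr0_norm ?subr_gt0// ltrBlDl.
  by rewrite gt_min ltrD2l ltr_pdivrMr// ltr_pMr// ltr1n.
have : r <= t by apply: sup_upper_bound.
by rewrite leNgt tr.
Qed.

(** * The flow on the open ball and the time change *)

Section Flow.
Context {R : realType} {m : nat}.
Variables (f : 'I_m -> mpoly m R) (d : nat).
Local Notation g := (normalized_field f d).
Local Notation flows X :=
  (forall (t : R) i, is_derive t 1 (fun s => X s 0 i) (g (X t) 0 i)).

Lemma normalized_flow (Dg : 'rV[R]_m -> 'M[R]_m) (x0 : 'rV[R]_m) :
  C1_on_cdisc g Dg -> disc x0 ->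
  exists X : R -> 'rV[R]_m, [/\ X 0 = x0, forall t, disc (X t) & flows X].
Proof.
move=> hg x0d; have [K hK] := C1_on_cdisc_lipschitz hg.
have [X [X0 dX]] : exists X : R -> 'rV[R]_m, X 0 = x0 /\
    forall (t : R) i, is_derive t 1 (fun s => X s 0 i) (g (retract (X t)) 0 i).
  apply: (@picard _ _ (g \o retract) (`|K| * (2 * m%:R))) => u v /=.
  apply: le_trans (hK _ _ (retract_cdisc _) (retract_cdisc _)) _.
  apply: (@le_trans _ _ (`|K| * `|retract u - retract v|)).
    by rewrite ler_wpM2r// ler_norm.
  by rewrite -mulrA ler_wpM2l// retract_lipschitz.
have [C [C0 hC]] := ftilde_bounded f d.
pose z t := 1 - dotp (X t) (X t).
pose dz t := - (2 * dotp (g (retract (X t))) (X t)).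
have hz (t : R) : is_derive t 1 z (dz t).
  rewrite /dz -[X in is_derive _ _ _ X]add0r; apply: is_derive_sub.
  by rewrite mulrDl !mul1r [X in _ + X]dotpC; exact: is_derive_dotp.
have dzz t : `|dz t| <= 2 * C * `|z t|.
  rewrite /dz normrN normrM ger0_norm// -mulrA ler_wpM2l//.
  have [X1|X1] := leP (enorm (X t)) 1.
    rewrite retract_id// dotpC dotp_normalized_field normrM /z -sqr_enorm.
    by rewrite ler_wpM2r// hC.
  (* Outside the ball X is a multiple of a point of the sphere, where the radial component of [g]
     vanishes; so dz = 0. *)
  have n0 : 0 < enorm (X t) by apply: lt_trans X1.
  rewrite -[X in dotp _ X](_ : enorm (X t) *: retract (X t) = X t); last first.
    by rewrite /retract (max_r (ltW X1)) scalerA divff ?gt_eqF// scale1r.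
  rewrite dotpZr dotpC dotp_normalized_field.
  have -> : enorm (retract (X t)) = 1.
    by rewrite /retract (max_r (ltW X1)) enormZ gtr0_norm ?invr_gt0// mulVf ?gt_eqF.
  by rewrite expr1n subrr !mulr0 normr0 mulr_ge0.
(* The sign of z is still unknown, so the differential inequality is carried over to z^2. *)
have dzC t : `|2 * (z t * dz t)| <= 4 * C * (z t * z t).
  rewrite !normrM (ger0_norm (ler0n _ _)) -[X in _ <= _ * X]expr2 -real_normK ?num_real//.
  have := dzz t; move: `|dz t| `|z t| (normr_ge0 (z t)) => p q q0 pq.
  have : q * p <= q * (2 * C * q) by rewrite ler_wpM2l.
  rewrite expr2; nra.
have hw (c t : R) : is_derive t 1 (fun s => expR (c * s) * (z s * z s))
    (expR (c * t) * (c * (z t * z t) + 2 * (z t * dz t))).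
  have := is_derive_mul (is_derive_expRM c t) (is_derive_mul (hz t) (hz t)).
  by congr (is_derive _ _ _ _); ring.
have z00 : 0 < z 0 by rewrite /z X0 -sqr_enorm disc_sub_gt0.
(* exp(4C t) z^2 is nondecreasing and exp(-4C t) z^2 nonincreasing: the first bounds z^2 from below
   for t >= 0, the second for t <= 0. *)
have zn0 t : z t != 0.
  suff : 0 < z t * z t by move=> h; apply/eqP => z0; move: h; rewrite z0 mul0r ltxx.
  have [t0|/ltW t0] := leP 0 t.
    have : expR (4 * C * 0) * (z 0 * z 0) <= expR (4 * C * t) * (z t * z t).
      apply: (nondecreasing_line t0 (hw (4 * C))) => s _.
      rewrite mulr_ge0 ?expR_ge0//.
      by have := dzC s; rewrite ler_norml => /andP[h1 h2]; lra.
    rewrite mulr0 expR0 mul1r => h.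
    by rewrite -(pmulr_rgt0 _ (expR_gt0 (4 * C * t))); apply: lt_le_trans h; rewrite mulr_gt0.
  have hN s := is_deriveN (hw (- (4 * C)) s).
  have : - (expR (- (4 * C) * t) * (z t * z t)) <= - (expR (- (4 * C) * 0) * (z 0 * z 0)).
    apply: (nondecreasing_line t0 hN) => s _.
    rewrite oppr_ge0 mulr_ge0_le0 ?expR_ge0//.
    by have := dzC s; rewrite ler_norml => /andP[h1 h2]; lra.
  rewrite lerN2 mulr0 expR0 mul1r => h.
  by rewrite -(pmulr_rgt0 _ (expR_gt0 (- (4 * C) * t))); apply: lt_le_trans h; rewrite mulr_gt0.
have cz : continuous z by move=> t; exact: is_derive_continuous (hz t).
have zp t : 0 < z t.
  rewrite ltNge; apply/negP => zt.
  have [c _ /eqP] : exists2 c, c \in `[Num.min 0 t, Num.max 0 t] & z c = 0.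
    apply: IVT; first by rewrite le_max ge_min lexx.
    - exact: continuous_subspaceT.
    - by case: (leP 0 t) => _; rewrite ge_min le_max zt (ltW z00) ?orbT.
  by rewrite (negbTE (zn0 c)).
have Xd t : disc (X t).
  rewrite /disc/= -(@ltr_pXn2r _ 2)// ?nnegrE ?enorm_ge0// expr1n.
  by rewrite sqr_enorm -subr_gt0; exact: zp.
exists X; split=> // t i.
by have := dX t i; rewrite retract_id//; exact: disc_cdisc.
Qed.

Variable X : R -> 'rV[R]_m.
Hypotheses (d_gt0 : (0 < d)%N) (fd : vdegree f d).
Hypotheses (Xd : forall t, disc (X t)) (dX : flows X).

Let XC t : cdisc (X t). Proof. exact/disc_cdisc/Xd. Qed.

Lemma is_derive_rho (t : R) :
  is_derive t 1 (fun s => rho (X s)) (- (dotp (X t) (ftilde f d (X t)) * rho (X t))).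
Proof.
pose z s := 1 - dotp (X s) (X s).
have hz : is_derive t 1 z (- (2 * dotp (g (X t)) (X t))).
  rewrite -[X in is_derive _ _ _ X]add0r; apply: is_derive_sub.
  by rewrite mulrDl !mul1r [X in _ + X]dotpC; exact: is_derive_dotp.
have z0 : 0 < z t by rewrite /z -sqr_enorm disc_sub_gt0.
have := @is_derive1_comp _ Num.sqrt z t _ _ (is_derive1_sqrt z0) hz.
rewrite dotpC dotp_normalized_field sqr_enorm -/(z t).
have rE s : rho (X s) = Num.sqrt (z s) by rewrite /rho /z sqr_enorm.
rewrite (_ : (fun s => rho (X s)) = Num.sqrt \o z); last by apply/funext.
congr (is_derive _ _ _ _); rewrite rE -{2}(sqr_sqrtr (ltW z0)).
by field; rewrite gt_eqF// sqrtr_gt0.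
Qed.

(** The derivative of 1/rho cancels the radial term subtracted in [g], which leaves ftilde / rho =
    rho^(d-1) f(y). *)
Lemma is_derive_poincare_inv (t : R) i :
  is_derive t 1 (fun s => poincare_inv (X s) 0 i)
    (rho (X t) ^+ d.-1 * vfield f (poincare_inv (X t)) 0 i).
Proof.
have r0 := rho_gt0 (Xd t).
have dr := is_derive_rho t.
have rn0 : rho (X t) != 0 by rewrite gt_eqF.
have := is_derive_mul (is_deriveV (f := fun s => rho (X s)) rn0 dr) (dX t i).
rewrite (_ : (fun s => _) = fun s => poincare_inv (X s) 0 i); last first.
  by apply/funext => s; rewrite mxE.
congr (is_derive _ _ _ _).
have fE : ftilde f d (X t) 0 i = rho (X t) ^+ d * vfield f (poincare_inv (X t)) 0 i.
  by rewrite ftilde_scale// [LHS]mxE.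
have -> : g (X t) 0 i = ftilde f d (X t) 0 i - dotp (X t) (ftilde f d (X t)) * X t 0 i.
  by rewrite /normalized_field !mxE.
rewrite fE -[X in _ ^+ X * vfield _ _ _ _ - _](prednK d_gt0) (exprS _ d.-1).
by set q := dotp _ _; set p := _ ^+ d.-1; rewrite /GRing.scale /=; field.
Qed.

(** A version of [original_time] on the whole line with a natural exponent; being defined for
    negative times too, it can be inverted around 0. *)
Definition flow_time : R -> R := primitive (fun s => rho (X s) ^+ d.-1).

Let cspeed : continuous (fun s => rho (X s) ^+ d.-1).
Proof.
move=> t; apply: (@continuous_comp _ _ _ (fun s => rho (X s)) (fun r => r ^+ d.-1)); last exact: exprn_continuous.
exact: is_derive_continuous (is_derive_rho t).
Qed.

Lemma is_derive_flow_time (t : R) : is_derive t 1 flow_time (rho (X t) ^+ d.-1).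
Proof. exact: (is_derive_primitive t cspeed). Qed.

Lemma flow_time_continuous : continuous flow_time.
Proof. by move=> t; exact: is_derive_continuous (is_derive_flow_time t). Qed.

Lemma flow_time0 : flow_time 0 = 0.
Proof. exact: primitive0. Qed.

Lemma flow_time_lt s t : s < t -> flow_time s < flow_time t.
Proof.
move=> st; have [||c _ E] := @MVT _ flow_time (fun t => rho (X t) ^+ d.-1) _ _ st.
- by move=> c _; exact: is_derive_flow_time.
- by apply: continuous_subspaceT; exact: flow_time_continuous.
by rewrite -subr_gt0 E mulr_gt0 ?subr_gt0// exprn_gt0// rho_gt0.
Qed.

Lemma flow_time_le : {mono flow_time : s t / s <= t}.
Proof. exact/le_mono/flow_time_lt. Qed.

Lemma flow_time_ge0 t : 0 <= t -> 0 <= flow_time t.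
Proof. by move=> t0; rewrite -flow_time0 flow_time_le. Qed.

Lemma flow_time_ivt s t : 0 <= s -> s <= flow_time t -> 0 <= t ->
  exists tau, [/\ 0 <= tau, tau <= t & flow_time tau = s].
Proof.
move=> s0 st t0; have [||c] := @IVT _ flow_time 0 t s t0.
- by apply: continuous_subspaceT; exact: flow_time_continuous.
- by rewrite flow_time0 ge_min le_max s0 st orbT.
by rewrite in_itv/= => /andP[c0 ct] E; exists c.
Qed.

Lemma original_timeE t : 0 <= t -> original_time d X t = flow_time t.
Proof.
move=> t0; rewrite /flow_time primitive_ge0//; apply: eq_Rintegral => s _.
have -> : (d%:R - 1 : R) = d.-1%:R by rewrite -{1}(prednK d_gt0) -addn1 natrD addrK.
by rewrite powR_half// cdisc_sub_ge0.
Qed.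

Lemma original_solution : exists y : R -> 'rV[R]_m,
  (forall tau, y (flow_time tau) = poincare_inv (X tau)) /\
  forall tau i, is_derive (flow_time tau) 1 (fun s => y s 0 i)
    (vfield f (y (flow_time tau)) 0 i).
Proof.
have inj : injective flow_time by exact: inc_inj flow_time_le.
(* The inverse time change, with default 0 off the range. Every claim concerns a point
   [flow_time tau], interior to the range. *)
pose sigma t := xget 0 [set tau | flow_time tau = t].
have sigmaK : cancel flow_time sigma.
  by move=> tau; apply: inj; rewrite /sigma; case: xgetP => [y _ //|/(_ tau) []].
exists (fun t => poincare_inv (X (sigma t))); split=> [tau|tau i]; first by rewrite sigmaK.
have r0 : rho (X tau) ^+ d.-1 != 0 by rewrite expf_neq0// gt_eqF// rho_gt0.
have ds : is_derive (flow_time tau) 1 sigma (rho (X tau) ^+ d.-1)^-1.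
  apply: (is_derive_inverse _ _ (is_derive_flow_time tau) r0).
    by near=> s; exact: sigmaK.
  by near=> s; exact: flow_time_continuous.
have := @is_derive1_comp _ (fun s => poincare_inv (X s) 0 i) sigma (flow_time tau)
  (rho (X tau) ^+ d.-1 * vfield f (poincare_inv (X tau)) 0 i) _ _ ds.
rewrite sigmaK => /(_ (is_derive_poincare_inv tau i)).
by congr (is_derive _ _ _ _); rewrite mulrAC divff// mul1r.
Unshelve. all: by end_near. Qed.

Section OriginalSolution.
Variable y : R -> 'rV[R]_m.
Hypothesis yX : forall tau, y (flow_time tau) = poincare_inv (X tau).
Hypothesis dy : forall tau i, is_derive (flow_time tau) 1 (fun s => y s 0 i)
  (vfield f (y (flow_time tau)) 0 i).

Lemma original_solution_on (I : set R) :
  I `<=` range flow_time -> solution (vfield f) I y.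
Proof.
move=> IX; apply: (@is_derive_solution _ _ _ I y (vfield f \o y)) => //.
  by move=> t i /IX[tau _ <-]; exact: dy.
apply/subspace_continuousP => t /IX[tau _ <-].
apply: cvg_within_filter.
apply: continuous_comp; last exact: vfield_continuous.
by apply: rV_cvg => i; exact: is_derive_continuous (dy tau i).
Qed.

Lemma flow_time_lt_tmax tau : 0 <= tau ->
  ((flow_time tau)%:E < tmax (vfield f) (poincare_inv (X 0)))%E.
Proof.
move=> tau0; have tau1 : tau < tau + 1 by rewrite ltrDl.
(* One more unit of flow exhibits a solution that lives strictly longer. *)
apply: (@lt_le_trans _ _ (flow_time (tau + 1))%:E).
  by rewrite lte_fin flow_time_lt.
apply: ereal_sup_ubound; exists (flow_time (tau + 1)) => //; split.
  by rewrite -flow_time0 flow_time_lt// (le_lt_trans tau0).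
exists y; split; last by rewrite -yX flow_time0.
apply: original_solution_on => t; rewrite /= in_itv/= => /andP[t0 /ltW t1].
by have [s [_ _ <-]] := flow_time_ivt t0 t1 (le_trans tau0 (ltW tau1)); exists s.
Qed.

Lemma within_itv_bounded (u : R -> 'rV[R]_m) (b : R) :
  (forall i, {within `[0, b], continuous (fun t => u t 0 i)}) ->
  exists M, forall t, 0 <= t <= b -> `|u t| <= M.
Proof.
move=> cu; have cu' : {within `[0, b], continuous u} by exact: rV_continuous.
have /compact_bounded[M [_ hM]] := continuous_compact cu' (@segment_compact _ 0 b).
exists (`|M| + 1) => t tb; apply: (hM (`|M| + 1)).
  by rewrite (le_lt_trans (ler_norm _))// ltrDl.
by exists t.
Qed.

(* A solution living past all the times flow_time tau would be bounded on a
   compact interval containing them, hence so would be the flow. *)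
Lemma tmax_le_flow_time t :
  (forall B, exists2 tau, 0 <= tau & B < enorm (poincare_inv (X tau))) ->
  0 <= t -> (t%:E < tmax (vfield f) (poincare_inv (X 0)))%E ->
  exists2 tau, 0 <= tau & flow_time tau = t.
Proof.
move=> unb t0 /ereal_sup_gt[_ [tb [tb0 [z [hz z0]]] <-]]; rewrite lte_fin => ttb.
apply: contrapT => nt.
have lt_t tau : 0 <= tau -> flow_time tau < t.
  move=> tau0; rewrite ltNge; apply/negP => tle.
  by have [s [s0 _ E]] := flow_time_ivt t0 tle tau0; apply: nt; exists s.
have sub b : b <= t -> `[0, b]%classic `<=` `[0, tb[%classic.
  move=> bt r; rewrite /= !in_itv/= => /andP[-> rb].
  exact: le_lt_trans (le_trans rb bt) ttb.
have cz b i : b <= t -> {within `[0, b], continuous (fun s => z s 0 i)}.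
  move=> bt; apply: (continuous_subspaceW (sub b bt)).
  exact: solution_continuous hz.
have [M hM] := within_itv_bounded (fun i => cz t i (lexx t)).
(* [M] bounds the competitor z on [0, t], so its Euclidean norm stays below m M there; at
   [flow_time tau], however, z must equal T^-1 (X tau). *)
have [tau tau0] := unb (m%:R * M).
rewrite ltNge => /negP; apply; rewrite -yX.
set b := flow_time tau; have bt : b <= t by exact/ltW/lt_t.
have b0 : 0 <= b by exact: flow_time_ge0.
suff <- : z b = y b.
  by apply: le_trans (enorm_le_norm _) _; rewrite ler_wpM2l// hM// b0.
have inI s : 0 <= s <= b -> exists sigma, flow_time sigma = s.
  by move=> /andP[s0 sb]; have [r [_ _ E]] := flow_time_ivt s0 sb tau0; exists r.
have cy i : {within `[0, b], continuous (fun s => y s 0 i)}.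
  apply: (@solution_continuous _ _ (vfield f)); apply: original_solution_on.
  by move=> s; rewrite /= in_itv/= => /inI[r <-]; exists r.
have [M' hM'] := within_itv_bounded cy.
(* The polynomial field is only locally Lipschitz; this ball contains both solutions on [0, b]. *)
have [K [_ _ hK]] := vfield_lipschitz f (Num.max M M').
apply: (@ode_unique _ _ (vfield f) K b z y _ (fun i => cz b i bt) cy); last first.
- by rewrite b0 lexx.
- by rewrite z0 -yX flow_time0.
- by move=> s i /andP[s0 sb]; have [|r <-] := inI s; [rewrite !ltW|exact: dy].
- move=> s i /andP[s0 sb]; apply: solution_is_derive hz _.
  apply: filterS (_ : nbhs s `]0, tb[%classic).
    by move=> r; rewrite /= !in_itv/= => /andP[/ltW -> ->].
  apply: open_nbhs_nbhs; split; first exact: interval_open.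
  by rewrite /= in_itv/= s0 (lt_trans sb)// (le_lt_trans bt).
- move=> s /andP[s0 sb]; apply: hK; rewrite le_max.
    by rewrite hM// s0 (le_trans sb bt).
  by rewrite hM' ?orbT// s0 sb.
Qed.

End OriginalSolution.

End Flow.

(** * Gradients, exponential decay and bounds on integrals *)

Lemma diff_gradient (R : realType) (m : nat) (L : 'rV[R]_m -> R) (x v : 'rV[R]_m) :
  differentiable L x -> 'd L x v = dotp (gradient L x) v.
Proof.
move=> dL; rewrite {1}[v]row_sum_delta linear_sum; apply: eq_bigr => i _.
by rewrite linearZ/= mxE deriveE// mulrC.
Qed.

(** The differential inequality is known only while phi <= e. That region is trapping: at phi = e
    the derivative is negative, so phi cannot cross. Then exp(b t) phi is nonincreasing. *)
Lemma exp_decay (R : realType) (phi : R -> R) (a e b : R) :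
  continuous phi -> 0 < e -> 0 < b -> phi a <= e ->
  (forall t, a <= t -> phi t <= e ->
    exists2 D, is_derive t 1 phi D & D < - b * phi t) ->
  forall t, a <= t -> phi t <= e * expR (- b * (t - a)).
Proof.
move=> cphi e0 b0 phia hD.
have trap : forall t, a <= t -> phi t <= e.
  apply: (@right_propagation _ [set t | phi t <= e]) => //.
    by apply: (preimage_closed _ (@closed_le _ e)) => t _; exact: cphi.
  move=> t at_ /=; rewrite le_eqVlt => /predU1P[phit|phit]; last first.
    have : \forall s \near t, phi s < e by apply: (cvgr_lt _ (cphi t)).
    by apply: filterS => s /ltW.
  have [|D /is_derive_quotientP hq Dlt] := hD t at_; first by rewrite phit.
  have D0 : D < 0 by apply: lt_trans Dlt _; rewrite phit mulNr oppr_lt0 mulr_gt0.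
  have hq0 : \forall s \near t, s != t -> (s - t)^-1 * (phi s - phi t) < 0.
    by apply: (cvgr_lt D hq).
  apply: filterS hq0 => s hs ts; have := hs (negbT (gt_eqF ts)).
  by rewrite pmulr_rlt0 ?invr_gt0 ?subr_gt0// subr_lt0 phit => /ltW.
move=> t at_; pose dphi s := 'D_1 phi s.
have dphiP s : a <= s -> is_derive s 1 phi (dphi s) /\ dphi s <= - b * phi s.
  move=> as_; have [D [h1 h2] Dlt] := hD s as_ (trap s as_).
  by split; [apply: DeriveDef|rewrite /dphi h2 ltW].
have : - (expR (b * a) * phi a) <= - (expR (b * t) * phi t).
  apply: (@nondecreasing_itv _ (fun s => - (expR (b * s) * phi s))
    (fun s => - (b * expR (b * s) * phi s + expR (b * s) * dphi s))) => //.
  - move=> s /andP[/ltW as_ _]; apply: is_deriveN; apply: is_derive_mul.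
      exact: is_derive_expRM.
    by case: (dphiP s as_).
  - move=> s /andP[/ltW as_ _]; have [_ h] := dphiP s as_.
    rewrite (_ : - _ = expR (b * s) * (- b * phi s - dphi s)); last by ring.
    by rewrite mulr_ge0 ?expR_ge0// subr_ge0.
  - apply: continuous_subspaceT; apply: continuous_opp; apply: continuous_mul => // s.
    exact: is_derive_continuous (is_derive_expRM b s).
rewrite lerN2 => h.
rewrite -(ler_pM2l (expR_gt0 (b * t))) (le_trans h)// mulrCA -expRD.
rewrite (_ : b * t + - b * (t - a) = b * a); last by ring.
by rewrite mulrC ler_wpM2r ?expR_ge0.
Qed.

(** The function -(B/c) exp(-c(t-a)) has the assumed bound as derivative and increases by at most
    B/c, uniformly in t. *)
Lemma exp_integral_bound (R : realType) (F dF : R -> R) (a B c : R) : 0 < c ->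
  (forall t : R, is_derive t 1 F (dF t)) ->
  (forall t, a <= t -> dF t <= B * expR (- c * (t - a))) -> 0 <= B ->
  forall t, a <= t -> F t <= F a + B / c.
Proof.
move=> c0 hF hB B0 t at_; pose E s := expR (c * a) * expR (- c * s).
have EE s : expR (- c * (s - a)) = E s.
  by rewrite /E -expRD; congr expR; ring.
have hE (s : R) : is_derive s 1 E (- c * E s).
  have := is_derive_scale (expR (c * a)) (is_derive_expRM (- c) s).
  by rewrite /E mulrCA.
have : - (B / c) * E a - F a <= - (B / c) * E t - F t.
  apply: (@nondecreasing_itv _ (fun s => - (B / c) * E s - F s)
    (fun s => - (B / c) * (- c * E s) - dF s)) => //.
  - move=> s /andP[/ltW as_ _]; rewrite subr_ge0.
    rewrite [leRHS](_ : _ = B * E s); last by field; rewrite gt_eqF.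
    by rewrite -EE hB.
  - apply: continuous_subspaceT; apply: continuous_sub.
      by move=> s; exact: is_derive_continuous (is_derive_scale (- (B / c)) (hE s)).
    by move=> s; exact: is_derive_continuous (hF s).
rewrite -!EE subrr mulr0 expR0 mulr1.
have : 0 <= B / c * expR (- c * (t - a)) by rewrite mulr_ge0 ?expR_ge0// divr_ge0// ltW.
by rewrite !mulNr; lra.
Qed.

Lemma exp_decay_lt (R : realType) (Q k r a : R) : 0 < Q -> 0 < k -> 0 < r ->
  exists2 t, a <= t & Q * expR (- k * (t - a)) < r.
Proof.
(* Found from exp(u) >= 1 + u with u = Q/r, which gives r exp(u) >= r + Q > Q. *)
move=> Q0 k0 r0; exists (a + Q / (r * k)).
  by rewrite lerDl ltW// divr_gt0// mulr_gt0.
rewrite addrC addKr mulNr expRN -ltr_pdivlMr ?invr_gt0 ?expR_gt0// invrK.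
have h := expR_ge1Dx (k * (Q / (r * k))).
have E : r * (k * (Q / (r * k))) = Q by field; rewrite !gt_eqF.
have : r * (1 + k * (Q / (r * k))) <= r * expR (k * (Q / (r * k))).
  by rewrite ler_wpM2l// ltW.
by rewrite mulrDr mulr1 E; lra.
Qed.

(** * Estimates near the equilibrium *)

Section QuadraticForm.
Context {R : realType} {m : nat}.
Variables (Y : 'M[R]_m) (xs : 'rV[R]_m) (c1 : R).
Hypotheses (m_gt0 : (0 < m)%N) (Y_sym : Y^T = Y).
Hypothesis Y_pos : forall mu : R, eigenvalue Y mu -> 0 < mu.
Hypothesis c1_ub : ubound [set mu^-1 | mu in [set mu : R | eigenvalue Y mu]] c1.

(** The Rayleigh bound with the smallest eigenvalue mu gives the factor 1/mu, which is at most
    [c1]. *)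
Lemma qform_bound (w : 'rV[R]_m) : enorm w ^+ 2 <= c1 * ((w *m Y *m w^T) 0 0).
Proof.
have [mu Ymu hmu] := rayleigh_min m_gt0 Y_sym; have mu0 := Y_pos Ymu.
rewrite -dotpE sqr_enorm; have := hmu w; rewrite -ler_pdivlMl// => /le_trans; apply.
rewrite ler_wpM2r//; last by apply: c1_ub; exists mu.
by apply: le_trans (hmu w); rewrite mulr_ge0 ?dotp_ge0// ltW.
Qed.

End QuadraticForm.

(** Factor as (1 - |x|)(1 + |x|): the second factor is at most 2, and the first is |xs| - |x|. *)
Lemma one_sub_sqr_enorm_le (R : realType) (m : nat) (x xs : 'rV[R]_m) :
  cdisc x -> enorm xs = 1 -> 1 - enorm x ^+ 2 <= 2 * enorm (x - xs).
Proof.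
rewrite /cdisc/= => x1 xs1; have := enorm_dist xs x.
rewrite xs1 -[enorm (xs - x)]enormN opprB => h; have := le_trans (ler_norm _) h.
have x0 := enorm_ge0 x; move: (enorm (x - xs)) => D D1.
rewrite expr2; nra.
Qed.

(** The square root halves the decay rate and the exponent of [c1], and cancels the square of [eps];
    the power p then multiplies all three exponents. *)
Lemma powR_speed_bound (R : realType) (z c1 eps b s p : R) :
  0 <= z -> 0 <= c1 -> 0 <= eps -> 0 <= p ->
  z <= 2 * Num.sqrt (c1 * (eps ^+ 2 * expR (- b * s))) ->
  z `^ p <= 2 `^ p * c1 `^ (p / 2) * eps `^ p * expR (- (b * p / 2) * s).
Proof.
move=> z0 c0 e0 p0 zle.
apply: le_trans (ge0_ler_powR p0 _ _ zle) _; rewrite ?nnegrE ?mulr_ge0 ?sqrtr_ge0//.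
rewrite powRM ?sqrtr_ge0// -powR12_sqrt ?mulr_ge0 ?expR_ge0 ?sqr_ge0//.
rewrite -powRrM powRM ?mulr_ge0 ?expR_ge0 ?sqr_ge0//.
rewrite powRM ?expR_ge0 ?sqr_ge0// -powR_mulrn// -powRrM -expRM.
rewrite mulrA mulrA le_eqVlt; apply/orP; left; apply/eqP.
congr (_ * _ `^ _ * _ `^ _ * expR _); first by rewrite mulrC.
  by field.
by field.
Qed.

(** Amplitude over rate for the integrated speed; the division by [c1] accounts for (d-5)/4 = p/2 -
    1. *)
Lemma upper_bound_constant (R : realType) (c1 cN eps : R) (d : nat) :
  0 < c1 -> 0 < cN -> (1 < d)%N -> let p := (d%:R - 1) / 2 in
  2 `^ p * c1 `^ (p / 2) * eps `^ p / (cN * c1 * p / 2) =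
  2 `^ ((d%:R - 1) / 2) * c1 `^ ((d%:R - 5) / 4) / cN
    * (4 / (d%:R - 1)) * eps `^ ((d%:R - 1) / 2).
Proof.
move=> c0 N0 d1 p.
have d0 : 0 < d%:R - 1 :> R by rewrite subr_gt0 ltr1n.
have -> : (d%:R - 5) / 4 = p / 2 + - 1 :> R by rewrite /p; field.
have cn0 : c1 != 0 by rewrite gt_eqF.
rewrite (@powRD _ c1 (p / 2) (- 1)) ?cn0 ?implybT// powRN powRr1; last exact: ltW.
rewrite -/p; set u := c1 `^ _; set v := 2 `^ _; set w := eps `^ _.
by rewrite /p; field; rewrite cn0 !gt_eqF.
Qed.

(** * Trapping near the equilibrium and comparison of the two time scales *)

Theorem theorem3p6 (R : realType) (m : nat) (hm : (1 <= m)%N)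
  (f : 'I_m -> mpoly m R) (d : nat) (hd : (1 <= d)%N) (hf : vdegree f d)
  (Dg : 'rV[R]_m -> 'M[R]_m)
  (hg : C1_on_cdisc (normalized_field f d) Dg)
  (xs : 'rV[R]_m) (hxs : enorm xs = 1) (hxs_eq : normalized_field f d xs = 0)
  (Nt : set 'rV[R]_m) (hNt_sub : Nt `<=` cdisc) (hNt_compact : compact Nt)
  (hNt_nbhs : rel_interior cdisc Nt xs)
  (Y : 'M[R]_m) (hY_sym : Y^T = Y)
  (hY_pos : forall mu : R, eigenvalue Y mu -> 0 < mu)
  (L : 'rV[R]_m -> R)
  (hL : forall x, L x = ((x - xs) *m Y *m (x - xs)^T) 0 0)
  (hL_lyap : lyapunov_function (normalized_field f d) L Nt)
  (delta0 : R) (hdelta0 : 0 < delta0)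
  (hDg : forall x, Nt x -> forall lambda : R[i],
     eigenvalue (map_mx (real_complex R) (Dg x)) lambda ->
     complex.Re lambda <= - delta0)
  (c1 : R)
  (hc1 : [set mu^-1 | mu in [set mu : R | eigenvalue Y mu]] c1)
  (hc1_max : ubound [set mu^-1 | mu in [set mu : R | eigenvalue Y mu]] c1)
  (cN : R) (hcN : 0 < cN)
  (hL_decay : forall x, Nt x -> x <> xs ->
     orbital_derivative (normalized_field f d) L x < - cN * enorm (x - xs) ^+ 2
     /\ - cN * enorm (x - xs) ^+ 2 <= - cN * c1 * L x)
  (eps : R) (heps : 0 < eps)
  (N : set 'rV[R]_m)
  (hN : N = [set x | cdisc x /\ L x <= eps ^+ 2]) (hN_sub : N `<=` Nt)
  (tauN : R) (htauN : 0 <= tauN) (x : R -> 'rV[R]_m) (x0 : 'rV[R]_m)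
  (hx : solution (normalized_field f d) `[0, tauN] x)
  (hx_cdisc : forall tau, 0 <= tau <= tauN -> cdisc (x tau))
  (hx0 : x 0 = x0) (hx0_disc : disc x0)
  (hx_end : rel_interior cdisc N (x tauN)) :
  exists X : R -> 'rV[R]_m,
    [/\ forall tau, 0 <= tau <= tauN -> X tau = x tau,
        solution (normalized_field f d) `[0, +oo[ X,
        forall tau, 0 <= tau -> disc (X tau) &
        exists y : R -> 'rV[R]_m,
          let y0 := poincare_inv x0 in
          let tm := tmax (vfield f) y0 in
          let dom := [set t : R | 0 <= t /\ (t%:E < tm)%E] in
          let lower := original_time d x tauN in
          let upper : \bar R :=
            if d == 1%N then +oo%E
            else (lower
                  + 2 `^ ((d%:R - 1) / 2) * c1 `^ ((d%:R - 5) / 4) / cN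
                    * (4 / (d%:R - 1)) * eps `^ ((d%:R - 1) / 2))%:E in
          [/\ original_time d X @` `[0, +oo[ = dom,
              forall tau, 0 <= tau ->
                y (original_time d X tau) = poincare_inv (X tau),
              solution (vfield f) dom y /\ y 0 = y0,
              (lower%:E <= tm <= upper)%E &
              ((upper < +oo)%E -> blows_up (vfield f) y0)]].
Proof.
have [X [X0 Xd dX]] := normalized_flow hg hx0_disc.
have XC t : cdisc (X t) by exact/disc_cdisc/Xd.
have cX : continuous X.
  by apply: rV_continuous => i t; exact: is_derive_continuous (dX t i).
(* [g] is Lipschitz only on the closed ball, so uniqueness uses that both orbits stay there. *)
have xX t : 0 <= t <= tauN -> x t = X t.
  have [K hK] := C1_on_cdisc_lipschitz hg.
  apply: (@ode_unique _ _ (normalized_field f d) K).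
  - by move=> s sI; apply: hK => //; exact: hx_cdisc.
  - by move=> i; exact: solution_continuous hx.
  - by move=> i; apply: continuous_subspaceT; exact: rV_continuous_coord.
  - move=> s i s0; apply: solution_is_derive hx _.
    apply: filterS (_ : nbhs s `]0, tauN[%classic).
      by move=> r; rewrite /= !in_itv/= => /andP[/ltW -> /ltW ->].
    by apply: open_nbhs_nbhs; split; [exact: interval_open|rewrite /= in_itv].
  - by rewrite hx0 X0.
have c1_gt0 : 0 < c1 by case: hc1 => mu Ymu <-; rewrite invr_gt0; exact: hY_pos.
pose phi t := L (X t).
have qb t : enorm (X t - xs) ^+ 2 <= c1 * phi t.
  by rewrite /phi hL; exact: qform_bound.
(* The equilibrium lies on the sphere, which X never reaches; the strict decay of [L] therefore
   holds at every time spent in [Nt]. *)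
have X_neq t : X t <> xs by move=> E; have := Xd t; rewrite /disc/= E hxs ltxx.
have cphi : continuous phi.
  rewrite (_ : phi = (fun w => dotp (w *m Y) w) \o (fun t => X t - xs)); last first.
    by apply/funext => t; rewrite /phi hL /= dotpE.
  move=> t; apply: continuous_comp; last exact: qform_continuous.
  by apply: continuousB; [exact: cX|exact: cst_continuous].
have phiN t : phi t <= eps ^+ 2 -> Nt (X t).
  by move=> h; apply: hN_sub; rewrite hN.
pose b := cN * c1.
have b0 : 0 < b by rewrite mulr_gt0.
have phi_end : phi tauN <= eps ^+ 2.
  have tI : 0 <= tauN <= tauN by rewrite htauN lexx.
  move: hx_end => [_ /nbhs_singleton]; rewrite xX// => /(_ (XC _)).
  by rewrite hN => -[].
have decay : forall t, tauN <= t -> phi t <= eps ^+ 2 * expR (- b * (t - tauN)).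
  apply: exp_decay => //; first exact: exprn_gt0.
  move=> t _ /phiN Nt_t; have [h1 h2] := hL_decay _ Nt_t (X_neq t).
  have [[U [_ NtU CU]] _ _] := hL_lyap.
  have [dL _] := CU _ (NtU _ Nt_t).
  exists (orbital_derivative (normalized_field f d) L (X t)).
    rewrite /orbital_derivative -diff_gradient//.
    by apply: is_derive_diff_comp => //; exact/is_derive_rV.
  by apply: lt_le_trans h1 _; rewrite /b -(mulNr cN).
have z_le t : tauN <= t -> 1 - enorm (X t) ^+ 2 <=
    2 * Num.sqrt (c1 * (eps ^+ 2 * expR (- b * (t - tauN)))).
  move=> tt; apply: le_trans (one_sub_sqr_enorm_le (XC t) hxs) _.
  rewrite ler_wpM2l// -[leLHS]ger0_norm ?enorm_ge0// -sqrtr_sqr ler_wsqrtr//.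
  by apply: le_trans (qb t) _; rewrite ler_pM2l// decay.
have unb B : exists2 tau, 0 <= tau & B < enorm (poincare_inv (X tau)).
  (* With z = 1 - |X|^2 one has |T^-1 X|^2 = (1 - z)/z, which exceeds B^2 exactly when z < r. *)
  pose r := (`|B| ^+ 2 + 1)^-1.
  have B1 : 0 < `|B| ^+ 2 + 1 by rewrite ltr_wpDl// exprn_ge0.
  have r0 : 0 < r by rewrite invr_gt0.
  (* By [z_le], z is at most twice a square root, so the radicand must fall below (r/2)^2. *)
  have [|||t tt ht] := @exp_decay_lt _ (c1 * eps ^+ 2) b ((r / 2) ^+ 2) tauN.
  - by rewrite mulr_gt0// exprn_gt0.
  - exact: b0.
  - by rewrite exprn_gt0// divr_gt0.
  exists t; first exact: le_trans tt.
  set z := 1 - enorm (X t) ^+ 2.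
  have z0 : 0 < z by exact: disc_sub_gt0.
  have zr : z < r.
    apply: le_lt_trans (z_le t tt) _.
    set V := c1 * _; have r20 : 0 < r / 2 by rewrite divr_gt0.
    suff : Num.sqrt V < r / 2 by lra.
    by rewrite -[ltRHS]gtr0_norm// -sqrtr_sqr ltr_sqrt ?exprn_gt0// /V mulrA.
  apply: le_lt_trans (ler_norm B) _.
  rewrite -(@ltr_pXn2r _ 2)// ?nnegrE ?enorm_ge0// /poincare_inv enormZ exprMn.
  rewrite [`|_^-1|]gtr0_norm ?invr_gt0 ?sqrtr_gt0// exprVn sqr_sqrtr ?(ltW z0)// -/z.
  rewrite (_ : enorm (X t) ^+ 2 = 1 - z); last by rewrite /z; ring.
  rewrite mulrC ltr_pdivlMr//.
  have : z * (`|B| ^+ 2 + 1) < 1 by rewrite -ltr_pdivlMr// mul1r.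
  by rewrite mulrDr mulr1 mulrC; lra.
have [y [yX dy]] := original_solution hd hf Xd dX.
have tE := original_timeE hd Xd.
exists X; split; first by move=> t tI; rewrite xX.
- apply: (@is_derive_solution _ _ _ _ X (normalized_field f d \o X)) => //.
  have [_ _ cg _] := hg; apply: (continuous_within_comp _ _ cg) => //.
  exact: continuous_subspaceT.
- by move=> t _; exact: Xd.
exists y; move=> y0 tm dom lower upper.
have y0E : y0 = poincare_inv (X 0) by rewrite X0.
have lowerE : lower = flow_time d X tauN.
  transitivity (original_time d X tauN); last exact: tE.
  apply: eq_Rintegral => s; rewrite inE/= in_itv/= => sI.
  by rewrite (xX s sI).
have dom_range : dom = original_time d X @` `[0, +oo[.
  apply/seteqP; split=> t /=.
    move=> [t0]; rewrite /tm y0E => ttm.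
    have [tau tau0 <-] := tmax_le_flow_time Xd dX yX dy unb t0 ttm.
    by exists tau; rewrite ?tE// in_itv/= tau0.
  move=> [tau]; rewrite in_itv/= andbT => tau0 <-; rewrite tE//; split.
    exact: flow_time_ge0.
  by rewrite /tm y0E; exact: (flow_time_lt_tmax Xd dX yX dy).
have upper_ge : (tm <= upper)%E.
  rewrite /upper; case: ifPn => [_|d1]; first exact: leey.
  have {}d1 : (1 < d)%N by rewrite ltn_neqAle eq_sym d1.
  pose p : R := (d%:R - 1) / 2.
  have p0 : 0 < p by rewrite divr_gt0// subr_gt0 ltr1n.
  have Ec := upper_bound_constant eps c1_gt0 hcN d1.
  have cE : cN * c1 * p / 2 = b * p / 2 by [].
  rewrite -Ec -/p cE.
  set B := 2 `^ p * c1 `^ (p / 2) * eps `^ p; set c := b * p / 2.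
  have c0 : 0 < c by rewrite divr_gt0// mulr_gt0.
  have B0 : 0 <= B by rewrite !mulr_ge0// powR_ge0.
  have le_up t : tauN <= t -> flow_time d X t <= lower + B / c.
    rewrite lowerE; apply: (exp_integral_bound c0 (is_derive_flow_time Xd dX)) => // s ss.
    rewrite (_ : rho (X s) ^+ d.-1 = (1 - enorm (X s) ^+ 2) `^ p); last first.
      rewrite /p (_ : (d%:R - 1 : R) = d.-1%:R) ?powR_half ?cdisc_sub_ge0//.
      by rewrite -{1}(prednK hd) -addn1 natrD addrK.
    apply: powR_speed_bound (z_le s ss); rewrite ?cdisc_sub_ge0 ?ltW//.
  (* If [tm] exceeded the bound, the bound would itself be a time [flow_time tau]; but [flow_time]
     keeps growing strictly after tau and yet stays below the bound. *)
  rewrite leNgt; apply/negP => uptm.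
  have up0 : 0 <= lower + B / c.
    apply: addr_ge0; last by apply: divr_ge0 => //; exact: ltW.
    by rewrite lowerE; exact: (flow_time_ge0 Xd dX).
  have := uptm; rewrite /tm y0E => /(tmax_le_flow_time Xd dX yX dy unb up0).
  move=> [tau tau0 E].
  (* Later than tau, for strict growth, and later than [tauN], where [le_up] holds. *)
  pose t' := Num.max tau tauN + 1.
  have : flow_time d X tau < flow_time d X t'.
    by apply: flow_time_lt => //; rewrite ltr_pwDr// le_max lexx.
  rewrite E ltNge => /negP; apply; apply: le_up.
  by rewrite ler_wpDr// le_max lexx orbT.
split.
- by rewrite dom_range.
- by move=> tau tau0; rewrite tE.
- split; last by rewrite y0E -yX flow_time0.
  apply: (original_solution_on dy).
  by rewrite dom_range => t [tau]; rewrite /= in_itv/= andbT => tau0 <-; exists tau; rewrite ?tE.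
- rewrite upper_ge andbT lowerE ltW// /tm y0E.
  exact: (flow_time_lt_tmax Xd dX yX dy).
- exact: le_lt_trans upper_ge.
Qed.
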